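(* Let $\alpha\in(-\infty,0]$. Suppose that $F:\mathcal{C}_\alpha(\mathbb{R}^n)\to[0,\infty)$ is upper semicontinuous with respect to hypo-convergence, invariant under orthogonal transformations (that is, $F(f\circ\rho)=F(f)$ for all $f\in\mathcal{C}_\alpha(\mathbb{R}^n)$ and $\rho\in\mathrm{O}(n)$), and increasing with respect to Minkowski symmetrizations, that is, $$F(f)\le F(\tau_u^\alpha f)\qquad\text{for all }f\in\mathcal{C}_\alpha(\mathbb{R}^n)\text{ and all }u\in\mathbb{S}^{n-1}.$$ Then for every $f\in\mathcal{C}_\alpha(\mathbb{R}^n)$ we have $$F(f)\le F(f_{\rm sym}^{(\alpha)}).$$
   Context: For $\alpha\in(-\infty,0]$, a function $f:\mathbb{R}^n\to[0,\infty)$ is $\alpha$-concave if $\{f>0\}$ is convex and for all $x,y$ with $f(x),f(y)>0$ and $\lambda\in[0,1]$, $f(\lambda x+(1-\lambda)y)$ is at least $(\lambda f(x)^\alpha+(1-\lambda)f(y)^\alpha)^{1/\alpha}$ if $\alpha<0$, and at least $f(x)^\lambda f(y)^{1-\lambda}$ if $\alpha=0$. $\mathcal{C}_\alpha(\mathbb{R}^n)$ is the set of $\alpha$-concave, upper semicontinuous $f:\mathbb{R}^n\to[0,\infty)$, not identically zero, with $\lim_{|x|\to\infty}f(x)=0$. For $u\in\mathbb{S}^{n-1}$, $R_u(x)=x-2\langle x,u\rangle u$. The $\alpha$-Minkowski symmetral of $f\in\mathcal{C}_\alpha(\mathbb{R}^n)$ is $$\tau_u^\alpha f(x)=\sup_{y+z=x}\left(\tfrac12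 f(2y)^\alpha+\tfrac12 f(R_u(2z))^\alpha\right)^{1/\alpha}\ (\alpha<0),\qquad \tau_u^0 f(x)=\sup_{y+z=x}\sqrt{f(2y)f(R_u(2z))},$$ where for $\alpha<0$ the expression in the supremum is $0$ if one of the two values of $f$ is $0$. It again belongs to $\mathcal{C}_\alpha(\mathbb{R}^n)$. Base function: $\psi=\mathrm{base}_\alpha f:=(1-f^\alpha)/\alpha$ for $\alpha<0$ and $\mathrm{base}_0 f:=-\log f$, with value $+\infty$ where $f=0$. Then $\psi\in\mathrm{Conv}_{\rm c}(\mathbb{R}^n)$, the set of convex, lower semicontinuous, proper, coercive functions $\mathbb{R}^n\to(-\infty,+\infty]$. Let $\mathcal{L}\psi(x)=\sup_y(\langle x,y\rangle-\psi(y))$. The function $\psi_{\rm sym}$ is the unique radial (i.e. $\mathrm{O}(n)$-invariant) function in $\mathrm{Conv}_{\rm c}(\mathbb{R}^n)$ with $\mathcal{L}\psi_{\rm sym}(x)=\int_{\mathrm{O}(n)}\mathcal{L}\psi(\vartheta^{-1}x)\,d\eta(\vartheta)$ for all $x$, where $\eta$ is the Haar probability measure on $\mathrm{O}(n)$. The reflectional hypo-symmetrization of $f$ is $f_{\rm sym}^{(\alpha)}:=(1-\alpha\psi_{\rm sym})^{1/\alpha}$ for $\alpha<0$ and $f_{\rm sym}^{(0)}:=e^{-\psi_{\rm sym}}$ for $\alpha=0$ (value $0$ where $\psi_{\rm sym}=+\infty$); it belongs to $\mathcal{C}_\alpha(\mathbb{R}^n)$. A sequence $f_k$ hypo-converges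 to $f$ if for every $x$: $\limsup_k f_k(x_k)\le f(x)$ for every sequence $x_k\to x$, and $f_k(x_k)\to f(x)$ for at least one sequence $x_k\to x$. $F$ is upper semicontinuous with respect to hypo-convergence if $\limsup_k F(f_k)\le F(f)$ whenever $f_k,f\in\mathcal{C}_\alpha(\mathbb{R}^n)$ and $f_k$ hypo-converges to $f$. *)

(* Defs.v *)
From mathcomp Require Import all_boot all_order all_algebra.
From mathcomp Require Import all_classical all_reals all_analysis.

Set Implicit Arguments.
Unset Strict Implicit.
Unset Printing Implicit Defensive.

Import Order.TTheory GRing.Theory Num.Theory.
Import numFieldNormedType.Exports.

Local Open Scope classical_set_scope.
Local Open Scope ring_scope.

Section EuclideanSpace.
Context {R : realType} {n : nat}.

Definition dotv (x y : 'cV[R]_n) : R := \sum_i x i 0 * y i 0.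

(* The library's norm on matrices is the sup norm; this one is Euclidean. *)
Definition enorm (x : 'cV[R]_n) : R := Num.sqrt (dotv x x).

Definition reflection (u x : 'cV[R]_n) : 'cV[R]_n := x - (2 * dotv x u) *: u.

Definition orthogonal_group : set 'M[R]_n := [set t | t^T *m t = 1%:M].

End EuclideanSpace.

Arguments orthogonal_group : clear implicits.

(* n x n matrices with their Borel sigma-algebra *)
Notation mxborel R n := (g_sigma_algebraType (@open 'M[R]_n)).

(* A Borel probability measure on O(n) is encoded as a Borel probability
   measure on the space of all matrices that gives O(n) mass 1.  Since O(n)
   is compact, left invariance characterizes the Haar probability measure. *)
Definition is_haar (R : realType) (n : nat)
    (eta : probability (mxborel R n) R) : Prop :=
  eta (orthogonal_group R n) = 1%E /\
  forall (rho : 'M[R]_n) (A : set (mxborel R n)),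
    orthogonal_group R n rho -> measurable A ->
    eta [set (rho *m t : mxborel R n) | t in A] = eta A.

Section AlphaConcave.
Context {R : realType} {n : nat}.
Variable alpha : R.
Implicit Type f : 'cV[R]_n -> R.

(* Below, as alpha <= 0, the [else] branches are the case alpha = 0. *)

(* Only meaningful for a, b > 0, because 0 `^ p = 0 for p != 0. *)
Definition alpha_mean (lambda a b : R) : R :=
  if alpha < 0
  then (lambda * a `^ alpha + (1 - lambda) * b `^ alpha) `^ alpha^-1
  else a `^ lambda * b `^ (1 - lambda).

Definition alpha_concave f : Prop :=
  @convex_set R 'cV[R]_n [set x | 0 < f x] /\
  forall x y lambda, 0 < f x -> 0 < f y -> 0 <= lambda <= 1 ->
    alpha_mean lambda (f x) (f y) <= f (lambda *: x + (1 - lambda) *: y).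

Definition upper_semicontinuous f : Prop :=
  forall x a, f x < a -> \forall y \near x, f y < a.

Definition vanishes_at_infinity f : Prop :=
  forall e, 0 < e -> exists r, forall x, r < enorm x -> `|f x| < e.

Definition Calpha : set ('cV[R]_n -> R) :=
  [set f | [/\ forall x, 0 <= f x, alpha_concave f, upper_semicontinuous f,
               exists x, f x != 0 & vanishes_at_infinity f]].

Definition symmetral_value (a b : R) : R :=
  if alpha < 0 then
    if (a == 0) || (b == 0) then 0
    else (2^-1 * a `^ alpha + 2^-1 * b `^ alpha) `^ alpha^-1
  else Num.sqrt (a * b).

(* For f in Calpha the set is nonempty and bounded above (f is bounded), so
   the real-valued [sup] is the true supremum. *)
Definition symmetral (u : 'cV[R]_n) f (x : 'cV[R]_n) : R :=
  sup [set r | exists y z, y + z = x /\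
    r = symmetral_value (f (2 *: y)) (f (reflection u (2 *: z)))].

Definition base_fun f (x : 'cV[R]_n) : \bar R :=
  if f x == 0 then +oo%E
  else if alpha < 0 then ((1 - f x `^ alpha) / alpha)%:E
  else (- ln (f x))%:E.

Definition unbase (psi : 'cV[R]_n -> \bar R) (x : 'cV[R]_n) : R :=
  if psi x is r%:E then
    if alpha < 0 then (1 - alpha * r) `^ alpha^-1 else expR (- r)
  else 0.

End AlphaConcave.

Section HypoConvergence.
Context {R : realType} {n : nat}.

Definition hypo_converges (fk : nat -> 'cV[R]_n -> R) (f : 'cV[R]_n -> R) :
    Prop :=
  forall x,
    (forall xk : nat -> 'cV[R]_n, xk k @[k --> \oo] --> x ->
       (limn_esup (fun k => (fk k (xk k))%:E) <= (f x)%:E)%E) /\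
    (exists2 xk : nat -> 'cV[R]_n, xk k @[k --> \oo] --> x &
       fk k (xk k) @[k --> \oo] --> f x).

Definition hypo_usc (C : set ('cV[R]_n -> R)) (F : ('cV[R]_n -> R) -> R) :
    Prop :=
  forall (fk : nat -> 'cV[R]_n -> R) (f : 'cV[R]_n -> R),
    (forall k, C (fk k)) -> C f -> hypo_converges fk f ->
    (limn_esup (fun k => (F (fk k))%:E) <= (F f)%:E)%E.

End HypoConvergence.

Section ReflectionalSymmetrization.
Context {R : realType} {n : nat}.
Implicit Types psi phi : 'cV[R]_n -> \bar R.
Local Open Scope ereal_scope.

(* The values exclude -oo, so no indeterminate sum occurs; 0 * +oo = 0. *)
Definition ext_convex psi : Prop :=
  forall x y (lambda : R), (0 <= lambda <= 1)%R ->
    psi (lambda *: x + (1 - lambda) *: y)%R <=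
    lambda%:E * psi x + (1 - lambda)%:E * psi y.

Definition coercive psi : Prop :=
  forall a : R, exists r : R, forall x, (r < enorm x)%R -> a%:E < psi x.

Definition Convc : set ('cV[R]_n -> \bar R) :=
  [set psi | [/\ forall x, psi x != -oo, ext_convex psi,
                 lower_semicontinuous psi, exists x, psi x != +oo
               & coercive psi]].

Definition legendre psi (x : 'cV[R]_n) : \bar R :=
  ereal_sup [set (dotv x y)%:E - psi y | y in [set: 'cV[R]_n]].

Definition radial psi : Prop :=
  forall t x, orthogonal_group R n t -> psi (t *m x)%R = psi x.

Definition is_psi_sym (eta : probability (mxborel R n) R) psi phi : Prop :=
  [/\ Convc phi, radial phi &
      forall x, legendre phi x =
        \int[eta]_(t in orthogonal_group R n) legendre psi (invmx t *m x)%R].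

(* [g] is the reflectional hypo-symmetrization of [f].  Stated relationally:
   the function [phi] is uniquely determined by [f]. *)
Definition is_hypo_sym (eta : probability (mxborel R n) R) (alpha : R)
    (f g : 'cV[R]_n -> R) : Prop :=
  exists2 phi, is_psi_sym eta (base_fun alpha f) phi & g = unbase alpha phi.

End ReflectionalSymmetrization.

(* Main.v *)
(* Let psi be the base function of f and h its Legendre transform.  A Minkowski
   symmetrization replaces h by (h + h o R_u) / 2, so it suffices to find finite
   words w_k of reflections such that the averages T_(w_k) h tend to the mean of h
   over O(n): then the iterated symmetrals f_k hypo-converge to f_sym, and
   F f <= F f_k passes to the limit by upper semicontinuity.  As h may take the
   value +oo, one works with the Lipschitz functions h_j conjugate to psi
   restricted to a ball of radius about j, which increase to h.

   Averaging along a word that moves a small cap around the minimum of a Lipschitz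
   function to every point of a finite net of the sphere lowers the maximum by a
   fixed amount, so some word makes h_j almost constant on any sphere; the constant
   is the Haar mean (its right invariance comes from the same argument on O(n)).

   The bound liminf base f_k >= psi_sym is the Fenchel inequality at the slope of
   a supporting cone of the radial function psi_sym.  For recovery points over
   a e (|e| = 1), minimize s |-> mean h_j (s e) - a s and take approximate
   subgradients of T_(w_k) h_j at points s_1 < s < s_2 of the line R e near the
   minimizer: they are almost parallel to e because the mean is radial, their
   e-components bracket a, and a convex combination of them is close to a e with
   nearly minimal value. *)

Require Import Defs.
From mathcomp Require Import all_boot all_order all_algebra.
From mathcomp Require Import all_classical all_reals all_analysis.
From mathcomp Require Import measurable_realfun ring lra.
Import Order.TTheory GRing.Theory Num.Theory.
Import numFieldNormedType.Exports.
Local Open Scope classical_set_scope.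
Local Open Scope ring_scope.

Set Implicit Arguments.
Unset Strict Implicit.
Unset Printing Implicit Defensive.

(** * Euclidean geometry *)

(** The words w_k need not extend one another: F f lies below F of every iterated symmetral, so w_k
    is chosen afresh for h_0, ..., h_k on the ball of radius k with error 1/(k+1).

    Truncation is harmless for recovery points, which may be taken from the part of the epigraph
    over a ball, but the lower bound needs the conjugate of the whole psi, that is h and not h_j. A
    growth estimate closes this gap. If the means of the h_j at y stay bounded, every cap of the
    sphere through y contains points where the h_j are below a common constant; hence psi grows at
    every rate r < |y| in all directions, and on a sphere of radius less than r a single h_J already
    equals h. This is why the slope of the supporting cone is first shrunk a little.

    A similar shrinking serves recovery: the target a e is moved slightly inside a point b e with
    psi_sym finite, so that the function minimized along the line is coercive. *)

Lemma norm_le_sqr (R : realDomainType) (a b : R) :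
  0 <= b -> a ^+ 2 <= b ^+ 2 -> `|a| <= b.
Proof. by move=> b0 ab; rewrite -(@ler_pXn2r _ 2)// real_normK ?num_real. Qed.

Section Euclidean.
Context {R : realType} {n : nat}.
Implicit Types x y z u : 'cV[R]_n.

Lemma dotvC x y : dotv x y = dotv y x.
Proof. by apply: eq_bigr => i _; rewrite mulrC. Qed.

Lemma dotvDl x y z : dotv (x + y) z = dotv x z + dotv y z.
Proof. by rewrite -big_split; apply: eq_bigr => i _; rewrite mxE mulrDl. Qed.

Lemma dotvZl a x y : dotv (a *: x) y = a * dotv x y.
Proof. by rewrite mulr_sumr; apply: eq_bigr => i _; rewrite mxE mulrA. Qed.

Lemma dotvDr x y z : dotv x (y + z) = dotv x y + dotv x z.
Proof. by rewrite dotvC dotvDl !(dotvC x). Qed.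

Lemma dotvZr a x y : dotv x (a *: y) = a * dotv x y.
Proof. by rewrite dotvC dotvZl dotvC. Qed.

Lemma dotvNl x y : dotv (- x) y = - dotv x y.
Proof. by rewrite -scaleN1r dotvZl mulN1r. Qed.

Lemma dotvNr x y : dotv x (- y) = - dotv x y.
Proof. by rewrite dotvC dotvNl dotvC. Qed.

Lemma dotvBl x y z : dotv (x - y) z = dotv x z - dotv y z.
Proof. by rewrite dotvDl dotvNl. Qed.

Lemma dotvBr x y z : dotv x (y - z) = dotv x y - dotv x z.
Proof. by rewrite dotvDr dotvNr. Qed.

Lemma dot0v x : dotv 0 x = 0.
Proof. by rewrite -(scale0r 0) dotvZl mul0r. Qed.

Lemma dotv0 x : dotv x 0 = 0.
Proof. by rewrite dotvC dot0v. Qed.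

Lemma dotv_ge0 x : 0 <= dotv x x.
Proof. by apply: sumr_ge0 => i _; rewrite -expr2 sqr_ge0. Qed.

Lemma dotv_eq0 x : (dotv x x == 0) = (x == 0).
Proof.
apply/idP/eqP => [|->]; last by rewrite dot0v.
rewrite psumr_eq0 => [/allP xx0|i _]; last by rewrite -expr2 sqr_ge0.
apply/matrixP => i j; rewrite ord1 mxE.
have := xx0 i (mem_index_enum _); rewrite implyTb.
by rewrite mulf_eq0 orbb => /eqP.
Qed.

Lemma enorm_ge0 x : 0 <= enorm x.
Proof. exact: sqrtr_ge0. Qed.

Lemma sqr_enorm x : enorm x ^+ 2 = dotv x x.
Proof. by rewrite sqr_sqrtr// dotv_ge0. Qed.

Lemma enorm_eq0 x : (enorm x == 0) = (x == 0).
Proof. by rewrite -dotv_eq0 -sqr_enorm expf_eq0. Qed.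

Lemma enorm0 : enorm (0 : 'cV[R]_n) = 0.
Proof. by apply/eqP; rewrite enorm_eq0. Qed.

Lemma enorm_gt0 x : (0 < enorm x) = (x != 0).
Proof. by rewrite lt_def enorm_ge0 andbT enorm_eq0. Qed.

Lemma enormZ a x : enorm (a *: x) = `|a| * enorm x.
Proof.
by rewrite /enorm dotvZl dotvZr mulrA -expr2 sqrtrM ?sqr_ge0// sqrtr_sqr.
Qed.

Lemma enormN x : enorm (- x) = enorm x.
Proof. by rewrite -scaleN1r enormZ normrN1 mul1r. Qed.

Lemma enormB x y : enorm (x - y) = enorm (y - x).
Proof. by rewrite -enormN opprB. Qed.

Lemma dotv_le x y : dotv x y <= enorm x * enorm y.
Proof.
have [->|y0] := eqVneq y 0; first by rewrite dotv0 enorm0 mulr0.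
have yy0 : 0 < dotv y y by rewrite lt_def dotv_eq0 y0 dotv_ge0.
have := dotv_ge0 (dotv y y *: x - dotv x y *: y).
rewrite !(dotvBl, dotvBr, dotvZl, dotvZr) (dotvC y x) => h.
have {}h : 0 <= dotv y y * (dotv x x * dotv y y - dotv x y ^+ 2).
  by apply: le_trans h _; rewrite le_eqVlt; apply/orP; left; apply/eqP; ring.
rewrite pmulr_rge0// subr_ge0 -!sqr_enorm -exprMn in h.
apply: le_trans (ler_norm _) _.
by apply: norm_le_sqr h; rewrite mulr_ge0 ?enorm_ge0.
Qed.

Lemma dotv_ge x y : - (enorm x * enorm y) <= dotv x y.
Proof. by rewrite lerNl -dotvNl -(enormN x) dotv_le. Qed.

Lemma enormD x y : enorm (x + y) <= enorm x + enorm y.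
Proof.
rewrite -(ler_pXn2r (ltn0Sn 1)) ?nnegrE ?addr_ge0 ?enorm_ge0// sqr_enorm.
rewrite sqrrD !sqr_enorm dotvDl !dotvDr (dotvC y x).
by have := dotv_le x y; lra.
Qed.

Lemma enormBD x y z : enorm (x - z) <= enorm (x - y) + enorm (y - z).
Proof. by apply: le_trans (enormD _ _); rewrite addrA subrK. Qed.

Lemma coord_le_enorm x i : `|x i 0| <= enorm x.
Proof.
apply: norm_le_sqr; rewrite ?enorm_ge0// sqr_enorm /dotv.
rewrite (bigD1 i)//= -expr2 lerDl; apply: sumr_ge0 => j _.
by rewrite -expr2 sqr_ge0.
Qed.

Lemma enorm_le_coord x d : (forall i, `|x i 0| <= d) -> enorm x <= n%:R * d.
Proof.
move=> xd; have [/eqP ->|x0] := boolP (x == 0).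
  rewrite enorm0; case: n x xd => [|m] x xd; first by rewrite mul0r.
  by rewrite mulr_ge0// (le_trans _ (xd 0)).
rewrite -enorm_gt0 in x0.
rewrite -(ler_pM2l x0) -expr2 sqr_enorm.
have -> : enorm x * (n%:R * d) = \sum_(i < n) enorm x * d.
  by rewrite sumr_const card_ord -[RHS]mulr_natr mulrCA mulrC.
apply: ler_sum => i _; apply: le_trans (ler_norm _) _.
by rewrite normrM ler_pM// coord_le_enorm.
Qed.

Lemma reflectionE u x : reflection u x = x - (2 * dotv x u) *: u.
Proof. by []. Qed.

Lemma reflectionD u x y : reflection u (x + y) = reflection u x + reflection u y.
Proof.
by rewrite !reflectionE dotvDl mulrDr scalerDl opprD addrACA.
Qed.

Lemma reflectionZ u a x : reflection u (a *: x) = a *: reflection u x.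
Proof. by rewrite !reflectionE dotvZl scalerBr scalerA mulrCA. Qed.

Lemma reflectionB u x y : reflection u (x - y) = reflection u x - reflection u y.
Proof. by rewrite reflectionD -scaleN1r reflectionZ scaleN1r. Qed.

Lemma dotv_reflection u x y :
  dotv (reflection u x) y = dotv x (reflection u y).
Proof. by rewrite !reflectionE !(dotvBl, dotvBr, dotvZl, dotvZr) (dotvC u y); ring. Qed.

Lemma reflectionK u : enorm u = 1 -> involutive (reflection u).
Proof.
move=> u1 x; rewrite !reflectionE dotvBl dotvZl -(sqr_enorm u) u1 expr1n mulr1.
by rewrite -addrA -opprD -scalerDl mulrBr -[in RHS](addr0 x); congr (_ + _);
  apply/eqP; rewrite oppr_eq0 scaler_eq0; apply/orP; left; apply/eqP; ring.
Qed.

Lemma dotv_reflection2 u x y : enorm u = 1 ->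
  dotv (reflection u x) (reflection u y) = dotv x y.
Proof. by move=> u1; rewrite dotv_reflection reflectionK. Qed.

Lemma enorm_reflection u x : enorm u = 1 -> enorm (reflection u x) = enorm x.
Proof. by move=> u1; rewrite /enorm dotv_reflection2. Qed.

(** The mirror is the bisecting hyperplane of [x] and [y], so [u] is [x - y] normalized; equal norms
    give [d ^+ 2 = 2 * dotv x (x - y)]. *)
Lemma reflection_swap x y : enorm x = enorm y -> x != y ->
  exists2 u, enorm u = 1 & reflection u x = y.
Proof.
move=> xy neq; pose d := enorm (x - y); have d0 : 0 < d by rewrite enorm_gt0 subr_eq0.
exists (d^-1 *: (x - y)).
  by rewrite enormZ gtr0_norm ?invr_gt0// mulVf// gt_eqF.
rewrite reflectionE dotvZr scalerA.
have -> : 2 * (d^-1 * dotv x (x - y)) * d^-1 = 1.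
  have dd : d ^+ 2 = 2 * dotv x (x - y).
    rewrite sqr_enorm !(dotvBl, dotvBr) -!sqr_enorm xy (dotvC y x); ring.
  have -> : 2 * (d^-1 * dotv x (x - y)) * d^-1 = 2 * dotv x (x - y) / d ^+ 2.
    by field; rewrite gt_eqF.
  by rewrite -dd divff// expf_neq0// gt_eqF.
by rewrite scale1r opprB addrC subrK.
Qed.

Lemma exists_unit : (0 < n)%N -> exists u : 'cV[R]_n, enorm u = 1.
Proof.
case: n => // m _; exists (delta_mx 0 0); rewrite /enorm /dotv.
rewrite big_ord_recl big1 ?mxE ?eqxx ?mulr1 ?addr0 ?sqrtr1// => i _.
by rewrite mxE mul0r.
Qed.

Lemma unit_direction x : (0 < n)%N ->
  exists2 e, enorm e = 1 & x = enorm x *: e.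
Proof.
move=> n0; have [->|x0] := eqVneq x 0.
  by have [u u1] := exists_unit n0; exists u; rewrite // enorm0 scale0r.
exists ((enorm x)^-1 *: x).
  by rewrite enormZ gtr0_norm ?invr_gt0 ?enorm_gt0// mulVf// enorm_eq0.
by rewrite scalerA mulfV ?enorm_eq0// scale1r.
Qed.

Lemma orthogonalP (t : 'M[R]_n) : orthogonal_group R n t -> t^T *m t = 1%:M /\ t *m t^T = 1%:M.
Proof. by move=> tt; split => //; apply: mulmx1C. Qed.

Lemma dotvE x y : dotv x y = (x^T *m y) 0 0.
Proof. by rewrite mxE; apply: eq_bigr => i _; rewrite mxE. Qed.

Lemma dotv_mulmx (t : 'M[R]_n) x y : dotv (t *m x) y = dotv x (t^T *m y).
Proof. by rewrite !dotvE trmx_mul mulmxA. Qed.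

Lemma enorm_orthogonal (t : 'M[R]_n) x : orthogonal_group R n t -> enorm (t *m x) = enorm x.
Proof. by move=> tt; rewrite /enorm dotv_mulmx mulmxA tt mul1mx. Qed.

Lemma orthogonal_trmx (t : 'M[R]_n) : orthogonal_group R n t -> orthogonal_group R n t^T.
Proof. by move=> /orthogonalP[_ tt]; rewrite /orthogonal_group /= trmxK. Qed.

Lemma orthogonal_mul (t s : 'M[R]_n) : orthogonal_group R n t ->
  orthogonal_group R n s -> orthogonal_group R n (t *m s).
Proof.
rewrite /orthogonal_group /= => tt ss.
by rewrite trmx_mul mulmxA -(mulmxA s^T) tt mulmx1.
Qed.

Lemma orthogonal_invmx (t : 'M[R]_n) : orthogonal_group R n t -> invmx t = t^T.
Proof.
move=> /orthogonalP[tt tt']; have ut : t \in unitmx by case: (mulmx1_unit tt).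
by rewrite -[LHS]mul1mx -tt mulmxK.
Qed.

Definition reflection_mx u : 'M[R]_n := 1%:M - 2 *: (u *m u^T).

Lemma reflection_mxE u x : reflection_mx u *m x = reflection u x.
Proof.
rewrite mulmxBl mul1mx reflectionE -scalemxAl -mulmxA; congr (_ - _).
by rewrite (mx11_scalar (u^T *m x)) -dotvE mul_mx_scalar scalerA dotvC.
Qed.

Lemma orthogonal_reflection u : enorm u = 1 -> orthogonal_group R n (reflection_mx u).
Proof.
move=> u1; rewrite /orthogonal_group /=.
have -> : (reflection_mx u)^T = reflection_mx u.
  by rewrite /reflection_mx linearB linearZ /= trmx1 trmx_mul trmxK.
apply/matrixP => i j; have := reflectionK u1 (delta_mx j 0).
rewrite -!reflection_mxE mulmxA => /matrixP /(_ i 0).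
by rewrite -colE !mxE eqxx andbT.
Qed.

Lemma radial_orthogonal x y : (0 < n)%N -> enorm x = enorm y ->
  exists2 t : 'M[R]_n, orthogonal_group R n t & t *m x = y.
Proof.
move=> n0 xy; have [->|neq] := eqVneq x y.
  by exists 1%:M; rewrite ?mul1mx// /orthogonal_group /= trmx1 mul1mx.
have [u u1 uxy] := reflection_swap xy neq.
by exists (reflection_mx u); [exact: orthogonal_reflection|rewrite reflection_mxE].
Qed.

End Euclidean.

(** * Averaging along words *)

Section Averaging.
Context {R : realType} {T : Type} {I : eqType}.
Variables (act : I -> T -> T) (G : set I).
Implicit Types (h : T -> R) (X : set T) (w : seq I).

(** The action is abstract because the averaging argument is run twice: for reflections acting on
    vectors and for right multiplications acting on orthogonal matrices. *)
Definition avg u h x : R := (h x + h (act u x)) / 2.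

Definition avgs w h : T -> R := foldl (fun h u => avg u h) h w.

Definition word w := forall u, u \in w -> G u.

Definition stable X := forall u, G u -> forall x, X x -> X (act u x).

Lemma avgs_cat w1 w2 h : avgs (w1 ++ w2) h = avgs w2 (avgs w1 h).
Proof. exact: foldl_cat. Qed.

Lemma word_cons u w : word (u :: w) -> G u /\ word w.
Proof.
move=> uw; split=> [|v vw]; apply: uw; first exact: mem_head.
by rewrite in_cons vw orbT.
Qed.

Lemma word_cat w1 w2 : word w1 -> word w2 -> word (w1 ++ w2).
Proof. by move=> ww1 ww2 u; rewrite mem_cat => /orP[/ww1|/ww2]. Qed.

Lemma avgs_closed (L : set (T -> R)) w h :
  (forall u h, G u -> L h -> L (avg u h)) -> word w -> L h -> L (avgs w h).
Proof.
move=> LG; elim: w h => [//|u w IH] h /word_cons[Gu ww] Lh.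
by apply: IH => //; exact: LG.
Qed.

Lemma avgs_bounds X w h a b : stable X -> word w ->
  (forall x, X x -> a <= h x <= b) -> forall x, X x -> a <= avgs w h x <= b.
Proof.
move=> sX; elim: w h => [//|u w IH] h /word_cons[Gu ww] hX.
apply: IH => // x Xx; have := hX _ Xx; have := hX _ (sX _ Gu _ Xx).
by rewrite /avg; lra.
Qed.

(** Lengthening a word never spoils what its beginning achieved, so spheres can be equalized one
    after the other. *)
Lemma avgs_osc X w h e : stable X -> word w ->
  (forall x y, X x -> X y -> h x - h y <= e) ->
  forall x y, X x -> X y -> avgs w h x - avgs w h y <= e.
Proof.
move=> sX; elim: w h => [//|u w IH] h /word_cons[Gu ww] hX.
apply: IH => // x y Xx Xy; have := hX _ _ Xx Xy.
by have := hX _ _ (sX _ Gu _ Xx) (sX _ Gu _ Xy); rewrite /avg; lra.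
Qed.

(* Each averaging step halves the gap below [M] but keeps it on the old set
   and spreads it to the image under one more map of the word. *)
Lemma avgs_gap X w h M d : stable X -> word w ->
  (forall x, X x -> h x <= M) ->
  forall x, X x -> (h x <= M - d \/ exists2 u, u \in w & h (act u x) <= M - d) ->
  avgs w h x <= M - d / 2 ^+ size w.
Proof.
move=> sX; elim: w h d => [|u w IH] h d ww hM x Xx.
  by rewrite expr0 divr1 => -[//|[]].
move: ww => /word_cons[Gu ww] hx.
have -> : d / 2 ^+ size (u :: w) = d / 2 / 2 ^+ size w.
  by rewrite /= exprS; field; rewrite expf_neq0.
have hu y : X y -> h (act u y) <= M by move=> Xy; apply: hM; exact: sX.
apply: IH => // [y Xy|]; first by have := hM _ Xy; have := hu _ Xy; rewrite /avg; lra.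
case: hx => [hx|[v]]; first by left; have := hu _ Xx; rewrite /avg; lra.
rewrite in_cons => /orP[/eqP ->|vw] hv.
  by left; have := hM _ Xx; rewrite /avg; lra.
right; exists v => //; have := hu _ (sX _ (ww _ vw) _ Xx); rewrite /avg; lra.
Qed.

(** The length bound [m] must not depend on [h] or [p]: it fixes the gain of each round of
    averaging, while both change from round to round. *)
Definition finitely_covered (L : set (T -> R)) X e := exists m, forall h p, L h -> X p ->
  exists w, [/\ word w, (size w <= m)%N & forall x, X x ->
    h x <= h p + e \/ exists2 u, u \in w & h (act u x) <= h p + e].

(** While two values on [X] differ by more than [e], the smaller one lies at least [e] below the
    upper bound. The covering word then has a gap of [e / 2] to spread, which lowers the upper bound
    by at least [k]. The lower bound [a] persists, so [N] such rounds suffice. *)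
Lemma avgs_equalize (L : set (T -> R)) X h e a b :
  stable X -> (forall u h, G u -> L h -> L (avg u h)) ->
  0 < e -> finitely_covered L X (e / 2) -> L h ->
  (forall x, X x -> a <= h x <= b) ->
  exists2 w, word w & forall x y, X x -> X y -> avgs w h x - avgs w h y <= e.
Proof.
move=> sX LG e0 [m cov] Lh hab; pose k := e / 2 / 2 ^+ m.
have k0 : 0 < k by rewrite !divr_gt0// exprn_gt0.
have [N bN] : exists N, b <= a + e + N%:R * k.
  exists (Num.truncn ((b - a) / k)).+1.
  have /ltW := Num.Theory.truncnS_gt ((b - a) / k).
  by rewrite ler_pdivrMr//; lra.
have {}hab x : X x -> a <= h x <= a + e + N%:R * k.
  by move=> /hab /andP[-> /=] /le_trans; exact.
clear bN; elim: N h Lh hab => [|N IH] h Lh hab.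
  exists [::] => // x y Xx Xy /=; have := hab _ Xx; have := hab _ Xy; lra.
have [osc|] := pselect (forall x y, X x -> X y -> h x - h y <= e).
  by exists [::].
move=> /existsNP[q /existsNP[p /not_implyP[Xq /not_implyP[Xp /negP]]]].
rewrite -ltNge => hqp.
have [w [ww wm wcov]] := cov _ _ Lh Xp.
have step x : X x -> a <= avgs w h x <= a + e + N%:R * k.
  move=> Xx; apply/andP; split.
    by have /andP[] := avgs_bounds sX ww hab Xx.
  have hM y : X y -> h y <= a + e + N.+1%:R * k by move=> /hab /andP[].
  apply: (le_trans (avgs_gap (d := e / 2) sX ww hM Xx _)).
    have := hM _ Xq; case: (wcov _ Xx) => [|[u uw]] hx hq; [left|right; exists u => //]; lra.
  have : k <= e / 2 / 2 ^+ size w.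
    rewrite ler_pM2l ?divr_gt0// lef_pV2 ?posrE ?exprn_gt0//.
    by rewrite ler_eXn2l// ltr1n.
  by rewrite -natr1; lra.
have [w' ww' osc] := IH _ (avgs_closed LG ww Lh) step.
by exists (w ++ w'); [exact: word_cat|rewrite avgs_cat].
Qed.

End Averaging.

(** Entries are rounded to a grid of step [d] and one point of [X] is kept per occupied cell. The
    net thus lies in [X] itself, as needed to join its points by orthogonal maps. *)
Lemma finite_net (R : realType) m n (X : set 'M[R]_(m, n)) B d : 0 < d ->
  (forall x, X x -> forall i j, `|x i j| <= B) ->
  exists s : seq 'M[R]_(m, n), (forall q, q \in s -> X q) /\
    forall x, X x -> exists2 q, q \in s & forall i j, `|x i j - q i j| <= d.
Proof.
move=> d0 XB.
have [[x0 Xx0]|X0] := pselect (exists x, X x); last first.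
  by exists [::]; split=> // x Xx; case: X0; exists x.
pose K := (Num.truncn (2 * B / d)).
pose cell (x : 'M[R]_(m, n)) i j := Num.truncn ((x i j + B) / d).
pose code x := [ffun p : 'I_m * 'I_n => inord (cell x p.1 p.2) : 'I_K.+1].
have cellK x i j : X x -> (cell x i j < K.+1)%N.
  move=> Xx; rewrite ltnS /cell /K le_truncn// ler_pM2r ?invr_gt0//.
  by have := XB _ Xx i j; rewrite ler_norml; lra.
have /choice[F FP] : forall c, exists y, X y /\
    ((exists2 x, X x & code x = c) -> code y = c).
  move=> c; have [[x Xx xc]|nc] := pselect (exists2 x, X x & code x = c).
    by exists x.
  by exists x0.
exists [seq F c | c <- enum {: {ffun 'I_m * 'I_n -> 'I_K.+1}}]; split.
  by move=> q /mapP[c _ ->]; exact: (FP c).1.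
move=> x Xx; exists (F (code x)); first by apply: map_f; rewrite mem_enum.
have [Xq qc] := FP (code x); move=> i j.
have := qc (ex_intro2 _ _ x Xx erefl).
move=> /(congr1 (fun f : {ffun 'I_m * 'I_n -> 'I_K.+1} => val (f (i, j)))) /=.
rewrite !ffunE !inordK ?cellK//= => qx.
have ge0 y : X y -> 0 <= (y i j + B) / d.
  by move=> Xy; rewrite divr_ge0 ?(ltW d0)//; have := XB _ Xy i j; rewrite ler_norml; lra.
have /andP[x1 x2] := truncn_itv (ge0 _ Xx).
have /andP[q1 q2] := truncn_itv (ge0 _ Xq).
rewrite -/(cell _ _ _) in x1 x2; rewrite -/(cell _ _ _) qx in q1 q2.
move: x1 x2 q1 q2; rewrite !ler_pdivlMr// !ltr_pdivrMr// -natr1 mulrDl mul1r.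
by rewrite ler_norml; lra.
Qed.

(** * Equalization on spheres and on the orthogonal group *)

Section Equalize.
Context {R : realType} {n : nat}.
Implicit Types (h : 'cV[R]_n -> R) (L e r : R).

Definition lipschitz L : set ('cV[R]_n -> R) :=
  [set h | forall x y, h x - h y <= L * enorm (x - y)].

Definition sphere r : set 'cV[R]_n := [set x | enorm x = r].

Definition unit_vectors : set 'cV[R]_n := sphere 1.

Definition ravgs := @avgs R 'cV[R]_n 'cV[R]_n reflection.

Definition rword := @word 'cV[R]_n unit_vectors.

Lemma lipschitz_avg L u h : unit_vectors u -> lipschitz L h ->
  lipschitz L (avg reflection u h).
Proof.
move=> u1 hL x y; have := hL x y; have := hL (reflection u x) (reflection u y).
by rewrite -reflectionB enorm_reflection// /avg; lra.
Qed.

Lemma lipschitz_ravgs L w h : rword w -> lipschitz L h -> lipschitz L (ravgs w h).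
Proof. by apply: avgs_closed => u g; exact: lipschitz_avg. Qed.

Lemma stable_sphere r : stable reflection unit_vectors (sphere r).
Proof. by move=> u u1 x <-; rewrite /sphere /= enorm_reflection. Qed.

Lemma lipschitz_sphere_bounds L h r x : lipschitz L h -> sphere r x ->
  h 0 - L * r <= h x <= h 0 + L * r.
Proof.
move=> hL xr; have := hL x 0; have := hL 0 x.
by rewrite sub0r subr0 enormN xr; lra.
Qed.

Lemma sphere_net r d : 0 < d -> exists s : seq 'cV[R]_n,
  (forall q, q \in s -> sphere r q) /\
  forall x, sphere r x -> exists2 q, q \in s & enorm (x - q) <= d.
Proof.
move=> d0; have n1 : 0 < n.+1%:R :> R by rewrite ltr0Sn.
have [s [sX sP]] : exists s : seq 'cV[R]_n, (forall q, q \in s -> sphere r q) /\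
    forall x, sphere r x -> exists2 q, q \in s &
      forall i j, `|x i j - q i j| <= d / n.+1%:R.
  apply: (@finite_net R n 1 (sphere r) r); first by rewrite divr_gt0.
  by move=> x <- i j; rewrite ord1 coord_le_enorm.
exists s; split=> // x /sP[q qs xq]; exists q => //.
apply: (le_trans (enorm_le_coord (d := d / n.+1%:R) _)) => [i|].
  by have := xq i 0; rewrite !mxE.
by rewrite mulrCA ger_pMr// ler_pdivrMr// mul1r ler_nat.
Qed.

(** The net depends only on [r], [L] and [e], so its size bounds the word for all [h] and [p]. A net
    point equal to [p] gets no letter and falls under the first alternative of the covering. *)
Lemma sphere_covered L r e : (0 < n)%N -> 0 <= L -> 0 < e ->
  finitely_covered reflection unit_vectors (lipschitz L) (sphere r) e.
Proof.
move=> n0 L0 e0; pose d := e / (L + 1); have L1 : 0 < L + 1 by lra.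
have d0 : 0 < d by rewrite divr_gt0.
have Lde : L * d <= e by rewrite mulrCA ger_pMr// ler_pdivrMr//; lra.
have [s [sX sP]] := sphere_net r d0; exists (size s) => h p hL pr.
have /choice[F FP] : forall q, exists u, sphere r q -> q != p ->
    enorm u = 1 /\ reflection u q = p.
  move=> q; have [[qr qp]|nqp] := pselect (sphere r q /\ q != p); last first.
    by exists 0 => qr qp; case: nqp.
  have [|u u1 uq] := @reflection_swap _ _ q p _ qp; first by rewrite qr pr.
  by exists u.
exists [seq F q | q <- s & q != p]; split.
- move=> u /mapP[q]; rewrite mem_filter => /andP[qp qs] ->.
  by have [] := FP _ (sX _ qs) qp.
- by rewrite size_map size_filter count_size.
move=> x xr; have [q qs xq] := sP _ xr; have [qp|qp] := eqVneq q p.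
  left; rewrite qp in xq; have := hL x p; have := ler_wpM2l L0 xq; lra.
right; exists (F q); first by apply: map_f; rewrite mem_filter qp.
have [Fq1 Fqp] := FP _ (sX _ qs) qp.
have := hL (reflection (F q) x) p.
rewrite -[in X in L * X]Fqp -reflectionB enorm_reflection//.
by have := ler_wpM2l L0 xq; lra.
Qed.

Lemma ravgs_equalize L (h : nat -> 'cV[R]_n -> R) (r : nat -> R) N e :
  (0 < n)%N -> 0 <= L -> 0 < e -> (forall i, lipschitz L (h i)) ->
  exists2 w, rword w & forall i, (i < N)%N -> forall x y,
    sphere (r i) x -> sphere (r i) y -> ravgs w (h i) x - ravgs w (h i) y <= e.
Proof.
move=> n0 L0 e0 hL; elim: N => [|N [w ww wP]]; first by exists [::].
have [||||||w' ww' w'P] := @avgs_equalize _ _ _ reflection unit_vectors (lipschitz L)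
  (sphere (r N)) (ravgs w (h N)) e (ravgs w (h N) 0 - L * r N) (ravgs w (h N) 0 + L * r N).
- exact: stable_sphere.
- by move=> u g; exact: lipschitz_avg.
- by [].
- by apply: sphere_covered => //; rewrite divr_gt0.
- exact: lipschitz_ravgs.
- by move=> x; apply: lipschitz_sphere_bounds; exact: lipschitz_ravgs.
exists (w ++ w'); first exact: word_cat.
move=> i; rewrite ltnS leq_eqVlt => /orP[/eqP -> x y xr yr|iN x y xr yr].
  by rewrite /ravgs avgs_cat; exact: w'P.
rewrite /ravgs avgs_cat; apply: (avgs_osc (@stable_sphere (r i)) ww') => // x' y'.
exact: wP.
Qed.

(** Only the radii [l * d] are equalized, up to [e / 2]; moving [x] and [y] radially onto such a
    sphere costs at most [L * d = e / 4] each. *)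
Lemma ravgs_equalize_ball L (h : nat -> 'cV[R]_n -> R) N K e :
  (0 < n)%N -> 0 < L -> 0 < e -> (forall i, lipschitz L (h i)) ->
  exists2 w, rword w & forall i, (i < N)%N -> forall x y,
    enorm x = enorm y -> enorm x <= K ->
    ravgs w (h i) x - ravgs w (h i) y <= e.
Proof.
move=> n0 L0 e0 hL; pose d := e / (4 * L).
have d0 : 0 < d by rewrite divr_gt0// mulr_gt0.
have Ld : L * d = e / 4 by rewrite /d; field; rewrite gt_eqF.
pose M := (Num.truncn (K / d)).+1.
(* The pair of a function index [i] and a radius index [l < M] is coded as [i * M + l]. *)
have [||||w ww wP] := @ravgs_equalize L (fun i => h (i %/ M)%N)
  (fun i => (i %% M)%:R * d) (N * M) (e / 2).
- by [].
- exact: ltW.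
- by rewrite divr_gt0.
- by [].
exists w => // i iN x y xy xK.
have [x0|x0] := eqVneq x 0.
  move: xy; rewrite x0 enorm0 => /esym/eqP; rewrite enorm_eq0 => /eqP ->.
  by rewrite subrr ltW.
rewrite -enorm_gt0 in x0; set r := enorm x in xy xK x0.
pose l := Num.truncn (r / d).
have lM : (l < M)%N by rewrite ltnS le_truncn// ler_pM2r ?invr_gt0.
have /andP[l1 l2] := truncn_itv (divr_ge0 (ltW x0) (ltW d0)).
rewrite -/l ler_pdivlMr// in l1; rewrite -/l ltr_pdivrMr// -natr1 in l2.
have ld0 : 0 <= l%:R * d by rewrite mulr_ge0// ltW.
have iM : (i * M + l < N * M)%N.
  by apply: (@leq_trans (i.+1 * M)%N); rewrite ?leq_mul2r ?iN ?orbT// mulSnr ltn_add2l.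
have close z : enorm z = r -> exists2 z', sphere (l%:R * d) z' &
    enorm (z - z') <= d.
  move=> zr; exists ((l%:R * d / r) *: z).
    rewrite /sphere /= enormZ zr ger0_norm ?divr_ge0 ?(ltW x0)//.
    by rewrite divfK// gt_eqF.
  have -> : z - (l%:R * d / r) *: z = (1 - l%:R * d / r) *: z by rewrite scalerBl scale1r.
  rewrite enormZ zr ger0_norm; last first.
    by rewrite subr_ge0 ler_pdivrMr// mul1r.
  by rewrite mulrBl divfK ?gt_eqF// mul1r; lra.
have [x' x'r xx'] := close x erefl; have [y' y'r yy'] := close y (esym xy).
have := wP (i * M + l)%N iM x' y'.
rewrite divnMDl// modnMDl (modn_small lM) (divn_small lM) addn0.
move=> /(_ x'r y'r) hxy.
have hw := lipschitz_ravgs ww (hL i).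
have := hw x x'; have := hw y' y; rewrite (enormB y').
have := ler_wpM2l (ltW L0) xx'; have := ler_wpM2l (ltW L0) yy'; lra.
Qed.

(** This matrix norm is chosen because right multiplication by an orthogonal matrix preserves it,
    and the averages on the group act by right multiplication. *)
Definition rownorm (A : 'M[R]_n) : R := \sum_i enorm (row i A)^T.

Lemma rownorm_mulmx (A t : 'M[R]_n) : orthogonal_group R n t ->
  rownorm (A *m t) = rownorm A.
Proof.
move=> tt; apply: eq_bigr => i _.
by rewrite row_mul trmx_mul enorm_orthogonal//; exact: orthogonal_trmx.
Qed.

Lemma rownormN (A : 'M[R]_n) : rownorm (- A) = rownorm A.
Proof. by apply: eq_bigr => i _; rewrite !linearN /= enormN. Qed.

Lemma enorm_mulmx_le (A : 'M[R]_n) x : enorm (A *m x) <= n%:R * (rownorm A * enorm x).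
Proof.
apply: enorm_le_coord => i.
have -> : (A *m x) i 0 = dotv (row i A)^T x.
  by rewrite mxE; apply: eq_bigr => j _; rewrite !mxE.
have rA : enorm (row i A)^T <= rownorm A.
  by rewrite /rownorm (bigD1 i)//= lerDl sumr_ge0// => j _; exact: enorm_ge0.
have := dotv_le (row i A)^T x; have := dotv_ge (row i A)^T x.
have := ler_wpM2r (enorm_ge0 x) rA; rewrite ler_norml; lra.
Qed.

Lemma rownorm_le_coord (A : 'M[R]_n) d : 0 <= d ->
  (forall i j, `|A i j| <= d / n.+1%:R / n.+1%:R) -> rownorm A <= d.
Proof.
move=> d0 hA; have n1 : 0 < n.+1%:R :> R by rewrite ltr0Sn.
have nn (c : R) : 0 <= c -> n%:R * (c / n.+1%:R) <= c.
  by move=> c0; rewrite mulrCA ler_piMr// ler_pdivrMr// mul1r ler_nat.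
apply: le_trans (nn _ d0).
rewrite mulr_natl -[X in _ *+ X]card_ord -sumr_const; apply: ler_sum => i _.
apply: le_trans (nn _ _); last by rewrite divr_ge0// ltW.
by apply: enorm_le_coord => j; have := hA i j; rewrite !mxE.
Qed.

Lemma orthogonal_coord (t : 'M[R]_n) i j : orthogonal_group R n t -> `|t i j| <= 1.
Proof.
move=> tt; have : enorm (t *m delta_mx j 0) = 1.
  rewrite enorm_orthogonal// /enorm /dotv (bigD1 j)//= big1 ?mxE ?eqxx ?mulr1 ?addr0 ?sqrtr1// => k kj.
  by rewrite mxE (negbTE kj) mul0r.
by move=> <-; have := coord_le_enorm (t *m delta_mx j 0) i; rewrite -colE mxE.
Qed.

Lemma orthogonal_net d : 0 < d -> exists s : seq 'M[R]_n,
  (forall q, q \in s -> orthogonal_group R n q) /\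
  forall t, orthogonal_group R n t -> exists2 q, q \in s & rownorm (t - q) <= d.
Proof.
move=> d0; have n1 : 0 < n.+1%:R :> R by rewrite ltr0Sn.
have d1 : 0 < d / n.+1%:R / n.+1%:R by rewrite !divr_gt0.
have [s [sX sP]] := finite_net d1 (fun t tt i j => orthogonal_coord i j tt).
exists s; split=> // t /sP[q qs tq]; exists q => //.
apply: (rownorm_le_coord (ltW d0)) => i j; have := tq i j; by rewrite !mxE.
Qed.

Definition rownorm_lipschitz C : set ('M[R]_n -> R) :=
  [set H | forall t s, H t - H s <= C * rownorm (t - s)].

Lemma lipschitz_orbit L h x : 0 <= L -> lipschitz L h ->
  rownorm_lipschitz (L * (n%:R * enorm x)) (fun t => h (t *m x)).
Proof.
move=> L0 hL t s; have := hL (t *m x) (s *m x); rewrite -mulmxBl => /le_trans; apply.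
rewrite -!mulrA ler_wpM2l//; have := enorm_mulmx_le (t - s) x.
by rewrite (mulrC (enorm x)).
Qed.

Lemma rownorm_lipschitz_avg C v H : orthogonal_group R n v -> rownorm_lipschitz C H ->
  rownorm_lipschitz C (avg (fun v t => t *m v) v H).
Proof.
move=> vv HL t s; have := HL t s; have := HL (t *m v) (s *m v).
by rewrite -mulmxBl rownorm_mulmx// /avg; lra.
Qed.

(** The covering argument for spheres carries over: right multiplication by [q^T *m p] takes a net
    point [q] to [p], and a matrix close to [q] to one equally close to [p]. *)
Lemma right_equalize L h x e : 0 <= L -> 0 < e -> lipschitz L h ->
  exists2 w : seq 'M[R]_n, word (orthogonal_group R n) w &
    forall t s, orthogonal_group R n t -> orthogonal_group R n s ->
      avgs (fun v t => t *m v) w (fun t : 'M[R]_n => h (t *m x)) t -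
      avgs (fun v t => t *m v) w (fun t : 'M[R]_n => h (t *m x)) s <= e.
Proof.
move=> L0 e0 hL; pose C := L * (n%:R * enorm x).
have C0 : 0 <= C by rewrite !mulr_ge0 ?enorm_ge0.
apply: (@avgs_equalize _ _ _ _ _ (rownorm_lipschitz C) _ _ e (h 0 - L * enorm x) (h 0 + L * enorm x)) => //.
- by move=> v vv t tt; exact: orthogonal_mul.
- by move=> v H; exact: rownorm_lipschitz_avg.
- pose d := e / 2 / (C + 1); have C1 : 0 < C + 1 by lra.
  have d0 : 0 < d by rewrite !divr_gt0.
  have Cd : C * d <= e / 2 by rewrite mulrCA ger_pMr ?divr_gt0// ler_pdivrMr//; lra.
  have [s [sX sP]] := orthogonal_net d0; exists (size s) => H p HL pp.
  exists [seq q^T *m p | q <- s]; split.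
  + by move=> v /mapP[q /sX qq ->]; apply: orthogonal_mul => //; exact: orthogonal_trmx.
  + by rewrite size_map.
  move=> t /sP[q qs tq]; right; exists (q^T *m p); first exact: map_f.
  have := HL (t *m (q^T *m p)) p.
  have [_ qq] := orthogonalP (sX _ qs).
  have -> : t *m (q^T *m p) - p = (t - q) *m (q^T *m p).
    by rewrite mulmxBl (mulmxA q) qq mul1mx.
  rewrite rownorm_mulmx; last first.
    by apply: orthogonal_mul => //; apply: orthogonal_trmx; exact: sX.
  by have := ler_wpM2l C0 tq; lra.
- exact: lipschitz_orbit.
- by move=> t tt; apply: (lipschitz_sphere_bounds hL); rewrite /sphere /= enorm_orthogonal.
Qed.

End Equalize.

(** * Compactness *)

Section Topology.
Context {R : realType} {n : nat}.
Implicit Types x y : 'cV[R]_n.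

Lemma near_enormP x (P : 'cV[R]_n -> Prop) :
  (\forall y \near x, P y) <-> exists2 d, 0 < d & forall y, enorm (y - x) < d -> P y.
Proof.
split=> [/nbhs_ballP[d /= d0 dP]|[d d0 dP]].
  exists d => // y yx; apply: dP; split => // i j.
  rewrite ord1 /ball /= distrC; apply: le_lt_trans yx.
  by have := coord_le_enorm (y - x) i; rewrite !mxE.
have n1 : 0 < n.+1%:R :> R by rewrite ltr0Sn.
apply/nbhs_ballP; exists (d / (2 * n.+1%:R)); first by rewrite /= divr_gt0// mulr_gt0.
move=> y [_ xy]; apply: dP.
apply: (@le_lt_trans _ _ (n%:R * (d / (2 * n.+1%:R)))).
  apply: enorm_le_coord => i; have := xy i 0; rewrite /ball /= distrC !mxE.
  exact: ltW.
rewrite mulrA ltr_pdivrMr ?mulr_gt0// mulrC ltr_pM2l//.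
by rewrite -natrM ltr_nat mul2n -addnn addSn ltnS leq_addr.
Qed.

(** This is the form in which compactness of balls is used throughout: a parameter that can be
    chosen uniformly near each point can be chosen uniformly on the ball. *)
Lemma compact_uniform r (Q : 'cV[R]_n -> R -> Prop) :
  (forall x d d', 0 < d' -> d' <= d -> Q x d -> Q x d') ->
  (forall x, exists2 d, 0 < d & forall x', enorm (x' - x) < d -> Q x' d) ->
  exists2 d, 0 < d & forall x, enorm x <= r -> Q x d.
Proof.
move=> Qd Qx.
(* The compact set is a box of row vectors, whence the transposes; it contains the transposed ball
   of radius [r]. *)
have /compact_near_coveringP cK := @rV_compact R n (fun=> `[- r, r]%classic)
  (fun=> @segment_compact _ _ _).
have [] := cK R (0^'+) (fun d (y : 'rV[R]_n) => Q y^T d).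
  move=> y _; have [d d0 dP] := Qx y^T.
  have : \forall z \near y^T, enorm (z - y^T) < d by apply/near_enormP; exists d.
  move=> /nbhs_ballP[e /= e0 eP].
  exists (ball y e, [set d' | 0 < d' < d]) => /=; [split|].
  - exact: nbhsx_ballx.
  - by near=> d'; apply/andP; split.
  move=> [y' d'] /= [[_ yy'] /andP[d'0 d'd]]; apply: (Qd _ d) => //; first exact: ltW.
  by apply: dP; apply: eP; split=> // i j; rewrite !mxE.
move=> e /= e0 eQ; exists (e / 2); first by rewrite divr_gt0.
have e2 : 0 < e / 2 by rewrite divr_gt0.
have e2e : e / 2 < e by rewrite ltr_pdivrMr// ltr_pMr// ltr1n.
move=> x xr; have := eQ (e / 2); rewrite /= sub0r normrN gtr0_norm//.
move=> /(_ e2e e2 x^T); rewrite /= trmxK; apply.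
move=> i /=; rewrite in_itv/= -ler_norml mxE; apply: le_trans xr.
exact: coord_le_enorm.
Unshelve. all: by end_near. Qed.

Lemma cvg_enormP (u : nat -> 'cV[R]_n) x :
  u k @[k --> \oo] --> x <-> forall e, 0 < e -> \forall k \near \oo, enorm (u k - x) < e.
Proof.
split=> [ux e e0|ux P].
  by apply: (ux (fun y => enorm (y - x) < e)); apply/near_enormP; exists e.
move=> /near_enormP[d d0 dP]; apply: filterS (ux d d0) => k; exact: dP.
Qed.

End Topology.

(** * Base functions *)

Section Base.
Context {R : realType}.
Variable alpha : R.
Implicit Types r s t : R.

Definition base t : R := if alpha < 0 then (1 - t `^ alpha) / alpha else - ln t.

Lemma baseE t : base t = if alpha < 0 then (1 - t `^ alpha) / alpha else - ln t.
Proof. by []. Qed.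

Definition ubase r : R :=
  if alpha < 0 then (1 - alpha * r) `^ alpha^-1 else expR (- r).

(* The range of [base] on positive reals. *)
Definition bdom r : Prop := alpha < 0 -> 0 < 1 - alpha * r.

Lemma baseK t : 0 < t -> ubase (base t) = t.
Proof.
move=> t0; rewrite /ubase /base; case: (ltP alpha 0) => a0; last first.
  by rewrite opprK lnK.
have an0 : alpha != 0 by rewrite lt_eqF.
have -> : 1 - alpha * ((1 - t `^ alpha) / alpha) = t `^ alpha by field.
by rewrite -powRrM mulfV// powRr1// ltW.
Qed.

Lemma ubaseK r : bdom r -> base (ubase r) = r.
Proof.
rewrite /bdom /ubase /base; case: (ltP alpha 0) => a0 dr; last by rewrite expRK opprK.
have an0 : alpha != 0 by rewrite lt_eqF.
by rewrite -powRrM mulVf// powRr1 ?ltW ?dr//; field.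
Qed.

Lemma ubase_gt0 r : bdom r -> 0 < ubase r.
Proof.
rewrite /bdom /ubase; case: (ltP alpha 0) => a0 dr; last exact: expR_gt0.
by rewrite powR_gt0// dr.
Qed.

Lemma base_bdom t : 0 < t -> bdom (base t).
Proof.
move=> t0 a0; rewrite /base a0.
have an0 : alpha != 0 by rewrite lt_eqF.
have -> : 1 - alpha * ((1 - t `^ alpha) / alpha) = t `^ alpha by field.
exact: powR_gt0.
Qed.

(** For [alpha < 0] the range of [base] is the open ray above [alpha^-1]. *)
Lemma bdom_le r s : bdom r -> r <= s -> bdom s.
Proof. by move=> dr rs a0; have := dr a0; have := ler_wnM2l (ltW a0) rs; lra. Qed.

Lemma lt_base s t : 0 < s -> 0 < t -> (base t < base s) = (s < t).
Proof.
move=> s0 t0; rewrite /base; case: (ltP alpha 0) => a0; last by rewrite ltrN2 ltr_ln.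
rewrite ltr_nM2r ?invr_lt0// ltrD2l ltrN2 /powR !gt_eqF//.
by rewrite ltr_expR ltr_nM2l// ltr_ln.
Qed.

Lemma le_base s t : 0 < s -> 0 < t -> (base t <= base s) = (s <= t).
Proof. by move=> s0 t0; rewrite leNgt lt_base// -leNgt. Qed.

Lemma le_ubase r s : bdom r -> bdom s -> (ubase s <= ubase r) = (r <= s).
Proof. by move=> dr ds; rewrite -le_base ?ubase_gt0// !ubaseK. Qed.

Lemma lt_ubase r s : bdom r -> bdom s -> (ubase s < ubase r) = (r < s).
Proof. by move=> dr ds; rewrite -lt_base ?ubase_gt0// !ubaseK. Qed.

Lemma bdom_conv l r s : bdom r -> bdom s -> 0 <= l <= 1 ->
  bdom (l * r + (1 - l) * s).
Proof.
move=> dr ds /andP[l0 l1]; have [rs|sr] := leP r s.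
  apply: bdom_le dr _; rewrite -subr_ge0.
  have -> : l * r + (1 - l) * s - r = (1 - l) * (s - r) by ring.
  by rewrite mulr_ge0 ?subr_ge0.
apply: bdom_le ds _; rewrite -subr_ge0.
have -> : l * r + (1 - l) * s - s = l * (r - s) by ring.
by rewrite mulr_ge0 ?subr_ge0// ltW.
Qed.

Lemma alpha_meanE l s t : 0 < s -> 0 < t ->
  alpha_mean alpha l s t = ubase (l * base s + (1 - l) * base t).
Proof.
move=> s0 t0; rewrite /alpha_mean /ubase /base; case: (ltP alpha 0) => a0.
  have an0 : alpha != 0 by rewrite lt_eqF.
  by congr (_ `^ _); field.
rewrite /powR !gt_eqF// -expRD; congr expR; ring.
Qed.

Lemma symmetral_valueE s t : 0 < s -> 0 < t ->
  symmetral_value alpha s t = ubase ((base s + base t) / 2).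
Proof.
move=> s0 t0; rewrite /symmetral_value !gt_eqF//=.
have [a0|a0] := boolP (alpha < 0).
  rewrite /ubase /base a0; have an0 : alpha != 0 by rewrite lt_eqF.
  by congr (_ `^ _); field.
rewrite /ubase /base (negbTE a0).
have -> : s * t = expR (- ((- ln s + - ln t) / 2)) ^+ 2.
  rewrite expr2 -expRD -{1}(lnK s0) -{1}(lnK t0) -expRD; congr expR; by field.
by rewrite sqrtr_sqr ger0_norm// expR_ge0.
Qed.

Lemma symmetral_value0 s t : s = 0 \/ t = 0 -> symmetral_value alpha s t = 0.
Proof.
by rewrite /symmetral_value => -[->|->]; rewrite eqxx ?orbT ?mul0r ?mulr0 ?sqrtr0 if_same.
Qed.

End Base.

(** * The class [Calpha] in terms of base functions *)

Section CalphaCharacterization.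
Context {R : realType} {n : nat}.
Variable alpha : R.
Implicit Types (f : 'cV[R]_n -> R) (x y z : 'cV[R]_n).

Local Notation base := (base alpha).
Local Notation bdom := (bdom alpha).

(** Through [base], convexity of the support and alpha-concavity merge into one convexity statement,
    and the two cases of [alpha] disappear. *)
Lemma CalphaP f : Calpha alpha f <->
  [/\ forall x, 0 <= f x,
      forall x y l, 0 < f x -> 0 < f y -> 0 <= l <= 1 ->
        0 < f (l *: x + (1 - l) *: y) /\
        base (f (l *: x + (1 - l) *: y)) <= l * base (f x) + (1 - l) * base (f y),
      forall x a, f x < a -> exists2 d, 0 < d & forall y, enorm (y - x) < d -> f y < a,
      exists x, 0 < f x &
      forall e, 0 < e -> exists r, forall x, r < enorm x -> f x < e].
Proof.
split=> [[f0 [_ fc] fu [x0 fx0] fv]|[f0 fc fu [x0 fx0] fv]]; split => //.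
- move=> x y l fx fy l01; have := fc x y l fx fy l01; rewrite alpha_meanE// => h.
  have d := bdom_conv (base_bdom (alpha := alpha) fx) (base_bdom fy) l01.
  have fxy := lt_le_trans (ubase_gt0 d) h; split => //.
  by rewrite -(ubaseK d) le_base// ubase_gt0.
- by move=> x a fxa; apply/near_enormP; exact: fu.
- by exists x0; rewrite lt_def fx0 f0.
- move=> e e0; have [r rP] := fv e e0; exists r => x /rP.
  by rewrite ger0_norm.
- split=> [x y p|x y l fx fy l01].
    rewrite !inE /= => fx fy.
    suff -> : conv p x y = p%:num *: x + (1 - p%:num) *: y.
      by apply: (fc x y p%:num fx fy _).1; rewrite ge0 le1.
    by [].
  have [fxy h] := fc x y l fx fy l01; rewrite alpha_meanE//.
  have d := bdom_conv (base_bdom (alpha := alpha) fx) (base_bdom fy) l01.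
  by rewrite -(le_base alpha) ?ubase_gt0// ubaseK.
- by move=> x a fxa; apply/near_enormP; exact: fu.
- by exists x0; rewrite gt_eqF.
- move=> e e0; have [r rP] := fv e e0; exists r => x /rP.
  by rewrite ger0_norm.
Qed.

Lemma base_funE f x : 0 < f x -> base_fun alpha f x = (base (f x))%:E.
Proof. by move=> fx; rewrite /base_fun gt_eqF// baseE; case: ifP. Qed.

Lemma base_fun0 f x : f x = 0 -> base_fun alpha f x = +oo%E.
Proof. by rewrite /base_fun => ->; rewrite eqxx. Qed.

Lemma Calpha_bounded f : Calpha alpha f -> exists2 M, 0 < M & forall x, f x <= M.
Proof.
move=> /CalphaP[f0 _ fu _ fv]; have [r rP] := fv 1 ltr01.
(* The reciprocal of [d] plays the role of a local upper bound. *)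
have [|x|d d0 dP] := @compact_uniform _ _ r (fun x d => f x <= d^-1).
- move=> x d d' d'0 dd' /le_trans; apply; rewrite lef_pV2// posrE//.
  exact: lt_le_trans dd'.
- have fx1 : 0 < f x + 1 by have := f0 x; lra.
  have [|d d0 dP] := fu x (f x + 1); first by rewrite ltrDl.
  exists (Num.min d (f x + 1)^-1); first by rewrite lt_min d0 invr_gt0.
  move=> y; rewrite lt_min => /andP[/dP /ltW fy _]; apply: le_trans fy _.
  rewrite -[leLHS]invrK lef_pV2 ?posrE ?lt_min ?d0 ?invr_gt0//.
  by rewrite ge_min lexx orbT.
exists (Num.max 1 d^-1); first by rewrite lt_max ltr01.
move=> x; rewrite le_max; have [/dP ->|/rP /ltW ->] := leP (enorm x) r.
  by rewrite orbT.
by [].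
Qed.

End CalphaCharacterization.

(** * Minkowski symmetrals *)

Lemma ge0_cases (R : numDomainType) (a : R) : 0 <= a -> a = 0 \/ 0 < a.
Proof. by rewrite le_eqVlt => /orP[/eqP <-|]; [left|right]. Qed.

Section Symmetral.
Context {R : realType} {n : nat}.
Variable alpha : R.
Implicit Types (f : 'cV[R]_n -> R) (u x y z p q : 'cV[R]_n).

Local Notation base := (base alpha).
Local Notation ubase := (ubase alpha).
Local Notation bdom := (bdom alpha).
Local Notation symmetral := (symmetral alpha).

Lemma bdom_half s t : 0 < s -> 0 < t -> bdom ((base s + base t) / 2).
Proof.
move=> s0 t0; have -> : (base s + base t) / 2 = 2^-1 * base s + (1 - 2^-1) * base t.
  by field.
by apply: bdom_conv; [exact: base_bdom|exact: base_bdom|lra].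
Qed.

(** That [m] lies in the range of [base] matters: every number above [m] is then in the range too,
    which later makes [unbase] invert correctly on the values of [phi]. *)
Lemma base_fun_lower f : Calpha alpha f ->
  exists2 m, bdom m & forall x, 0 < f x -> m <= base (f x).
Proof.
move=> /Calpha_bounded[M M0 fM]; exists (base M); first exact: base_bdom.
by move=> x fx; rewrite le_base.
Qed.

Lemma base_fun_coercive f B : Calpha alpha f ->
  exists r, forall x, 0 < f x -> base (f x) <= B -> enorm x <= r.
Proof.
move=> /CalphaP[f0 _ _ _ fv]; have [dB|ndB] := pselect (bdom B).
  have [r rP] := fv _ (ubase_gt0 dB); exists r => x fx fB.
  rewrite leNgt; apply/negP => /rP; apply/negP; rewrite -leNgt.
  by rewrite -(le_base alpha) ?ubase_gt0// ubaseK.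
by exists 0 => x fx fB; exfalso; apply: ndB; apply: bdom_le fB; exact: base_bdom.
Qed.

(** Guarding each inequality by positivity of [f] encodes the value +oo of the base function where
    [f] vanishes. *)
Lemma base_fun_lsc f x c : Calpha alpha f -> (0 < f x -> c < base (f x)) ->
  exists2 d, 0 < d & forall y, enorm (y - x) < d -> 0 < f y -> c < base (f y).
Proof.
move=> /CalphaP[f0 _ fu _ _] fxc; have [dc|ndc] := pselect (bdom c); last first.
  exists 1 => // y _ fy; rewrite ltNge; apply/negP => yc; apply: ndc.
  by apply: bdom_le yc; exact: base_bdom.
have fxuc : f x < ubase c.
  have := f0 x; rewrite le_eqVlt => /orP[/eqP <-|fx]; first exact: ubase_gt0.
  by rewrite -(lt_base alpha) ?ubase_gt0// ubaseK// fxc.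
have [d d0 dP] := fu _ _ fxuc; exists d => // y /dP fyc fy.
by rewrite -(ubaseK dc) lt_base// ubase_gt0.
Qed.

Let vals u f x := [set r | exists y z, y + z = x /\
  r = symmetral_value alpha (f (2 *: y)) (f (reflection u (2 *: z)))].

Let vals_sup u f x : Calpha alpha f -> has_sup (vals u f x).
Proof.
move=> fC; have [M M0 fM] := Calpha_bounded fC; move/CalphaP: fC => [f0 _ _ _ _].
split; first by exists (symmetral_value alpha (f (2 *: x)) (f (reflection u (2 *: 0)))), x, 0; rewrite addr0.
exists M => r [y [z [_ ->]]].
case: (ge0_cases (f0 (2 *: y))) => [->|fy].
  by rewrite symmetral_value0 ?ltW//; left.
case: (ge0_cases (f0 (reflection u (2 *: z)))) => [->|fz].
  by rewrite symmetral_value0 ?ltW//; right.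
have yM : base M <= base (f (2 *: y)) by rewrite le_base.
have zM : base M <= base (f (reflection u (2 *: z))) by rewrite le_base.
have d := base_bdom (alpha := alpha) M0.
have h : base M <= (base (f (2 *: y)) + base (f (reflection u (2 *: z)))) / 2 by lra.
rewrite symmetral_valueE// -[leRHS](baseK alpha M0) le_ubase//.
exact: bdom_le h.
Qed.

Lemma symmetral_ge0 f u x : Calpha alpha f -> 0 <= symmetral u f x.
Proof.
move=> fC; have [hn hb] := vals_sup u x fC; move/CalphaP: fC => [f0 _ _ _ _].
have [v vv] := hn; apply: (@le_trans _ _ v); last exact: ub_le_sup.
case: vv => y [z [_ ->]].
case: (ge0_cases (f0 (2 *: y))) => [->|fy].
  by rewrite symmetral_value0//; left.
case: (ge0_cases (f0 (reflection u (2 *: z)))) => [->|fz].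
  by rewrite symmetral_value0//; right.
rewrite symmetral_valueE// ltW// ubase_gt0//; exact: bdom_half.
Qed.

(** In terms of epigraphs, the half-sum of the epigraph of the base function and its reflection lies
    in the epigraph for the symmetral; [symmetral_approx] is the converse up to [e]. Together with
    nonnegativity, these two facts replace the supremum from here on. *)
Lemma symmetral_mem f u p q : Calpha alpha f -> enorm u = 1 -> 0 < f p -> 0 < f q ->
  0 < symmetral u f (2^-1 *: (p + reflection u q)) /\
  base (symmetral u f (2^-1 *: (p + reflection u q))) <= (base (f p) + base (f q)) / 2.
Proof.
move=> fC u1 fp fq; set x := 2^-1 *: _; have [hn hb] := vals_sup u x fC.
have d := bdom_half fp fq.
have h : ubase ((base (f p) + base (f q)) / 2) <= symmetral u f x.
  rewrite -symmetral_valueE//; apply: ub_le_sup => //.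
  exists (2^-1 *: p), (2^-1 *: reflection u q); rewrite -scalerDr; split => //.
  by rewrite !scalerA mulfV// !scale1r reflectionK.
have h0 := lt_le_trans (ubase_gt0 d) h; split => //.
by rewrite -(ubaseK d) le_base// ubase_gt0.
Qed.

Lemma symmetral_approx f u x e : Calpha alpha f -> enorm u = 1 ->
  0 < symmetral u f x -> 0 < e ->
  exists p q, [/\ 0 < f p, 0 < f q, x = 2^-1 *: (p + reflection u q) &
    (base (f p) + base (f q)) / 2 < base (symmetral u f x) + e].
Proof.
move=> fC u1 fx e0; have [hn hb] := vals_sup u x fC; move/CalphaP: fC => [f0 _ _ _ _].
have d := base_bdom (alpha := alpha) fx.
have d' : bdom (base (symmetral u f x) + e) by apply: bdom_le d _; lra.
(* The lowered level is still positive, so a decomposition reaching it has two positive values of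
   [f]. *)
have lt_sup : 0 < symmetral u f x - ubase (base (symmetral u f x) + e).
  rewrite subr_gt0 -[ltRHS](baseK alpha fx) lt_ubase//; lra.
have [v [y [z [yz ->]]]] := sup_adherent lt_sup (conj hn hb).
rewrite -/(symmetral u f x) opprB addrCA subrr addr0 => lt_v.
have ub0 := ubase_gt0 d'.
case: (ge0_cases (f0 (2 *: y))) => [fy|fy].
  by move: lt_v; rewrite fy symmetral_value0 ?(lt_gtF ub0)//; left.
case: (ge0_cases (f0 (reflection u (2 *: z)))) => [fz|fz].
  by move: lt_v; rewrite fz symmetral_value0 ?(lt_gtF ub0)//; right.
exists (2 *: y), (reflection u (2 *: z)); split => //.
  by rewrite reflectionK// -scalerDr yz scalerA mulVf// scale1r.
by move: lt_v; rewrite symmetral_valueE// lt_ubase//; exact: bdom_half.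
Qed.

(** A decomposition of a nearby point with average below [B] starts in a fixed ball, because the
    base function is coercive and bounded below. On that ball, lower semicontinuity and compactness
    exclude such averages uniformly. *)
Let symmetral_usc f u x a : Calpha alpha f -> enorm u = 1 ->
  symmetral u f x < a -> exists2 d, 0 < d &
    forall y, enorm (y - x) < d -> symmetral u f y < a.
Proof.
move=> fC u1 fxa; have sx0 := symmetral_ge0 u x fC.
pose a0 := (symmetral u f x + a) / 2.
have a00 : 0 < a0 by rewrite /a0; lra.
have xa0 : symmetral u f x < a0 by rewrite /a0; lra.
have a0a : a0 < a by rewrite /a0; lra.
pose B := base a0; have [m dm mP] := base_fun_lower fC.
have [r rP] := base_fun_coercive (2 * B + 2 - m) fC.
have Rc p q x' x'' : reflection u (2 *: x' - p) - reflection u (2 *: x'' - q) =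
    reflection u (2 *: (x' - x'') - (p - q)).
  by rewrite -reflectionB scalerBr; congr reflection;
    rewrite !opprB !addrA addrAC [in RHS]addrAC; congr (_ + _); rewrite addrAC.
(* [Q p d]: close to [x], the decompositions starting near [p] stay above [B]. *)
pose Q p d := forall y, enorm (y - x) < d ->
  0 < f p -> 0 < f (reflection u (2 *: y - p)) ->
  B < (base (f p) + base (f (reflection u (2 *: y - p)))) / 2.
have [|p|d d0 dQ] := @compact_uniform _ _ r Q.
- by move=> p d d' d'0 dd' Qp y yx; apply: Qp; exact: lt_le_trans dd'.
- pose q := reflection u (2 *: x - p).
  have xpq : 2^-1 *: (p + reflection u q) = x.
    by rewrite reflectionK// addrC subrK scalerA mulVf// scale1r.
  (* The level [2 * B] is split into strict lower bounds for the two summands. If [f] vanishes at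
     one point, its bound is free and the other can be [m - 1]; otherwise the excess over [B] is
     taken off both values. *)
  have [c1 [c2 [cB pc qc]]] : exists c1 c2, [/\ c1 + c2 = 2 * B,
      (0 < f p -> c1 < base (f p)) & (0 < f q -> c2 < base (f q))].
    have [fp|fp] := boolP (0 < f p); last first.
      exists (2 * B - (m - 1)), (m - 1); split; [lra|by []|].
      by move=> /mP; lra.
    have [fq|fq] := boolP (0 < f q); last first.
      exists (m - 1), (2 * B - (m - 1)); split; [lra| |by []].
      by move=> _; have := mP _ fp; lra.
    have [sx hx] := symmetral_mem fC u1 fp fq; rewrite xpq in sx hx.
    have : B < base (symmetral u f x) by rewrite lt_base.
    pose c := ((base (f p) + base (f q)) / 2 - B).
    exists (base (f p) - c), (base (f q) - c); split; rewrite /c; lra.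
  have [d1 d10 d1P] := base_fun_lsc fC pc.
  have [d2 d20 d2P] := base_fun_lsc fC qc.
  (* The second point of the decomposition moves by at most [2 * enorm (y - x) + enorm (p' - p)],
     hence the quarter of [d2]. *)
  exists (Num.min d1 (d2 / 4)); first by rewrite lt_min d10 divr_gt0.
  move=> p'; rewrite lt_min => /andP[p'1 p'2] y; rewrite lt_min => /andP[y1 y2] fp' fq'.
  have := d1P _ p'1 fp'.
  suff /d2P /(_ fq') : enorm (reflection u (2 *: y - p') - q) < d2 by lra.
  rewrite /q Rc enorm_reflection//.
  have := enormD (2 *: (y - x)) (- (p' - p)).
  by rewrite enormN enormZ ger0_norm//; lra.
exists d => // y yx; apply: le_lt_trans a0a.
rewrite leNgt; apply/negP => ya; have fy : 0 < symmetral u f y by exact: lt_trans ya.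
have yB : base (symmetral u f y) < B by rewrite lt_base.
pose e := Num.min 1 (B - base (symmetral u f y)).
have e0 : 0 < e by rewrite lt_min ltr01 subr_gt0.
have [p [q [fp fq ypq]]] := symmetral_approx fC u1 fy e0.
have e1 : e <= 1 by rewrite ge_min lexx.
have eB : e <= B - base (symmetral u f y) by rewrite ge_min lexx orbT.
move=> hpq.
have qE : q = reflection u (2 *: y - p).
  by rewrite ypq scalerA mulfV// scale1r addrAC subrr add0r reflectionK.
have := mP _ fq; have := mP _ fp => mp mq.
have pr : enorm p <= r by apply: rP => //; lra.
have := dQ p pr y yx fp; rewrite -qE => /(_ fq); lra.
Qed.

Lemma symmetral_Calpha f u : Calpha alpha f -> enorm u = 1 ->
  Calpha alpha (symmetral u f).
Proof.
move=> fC u1; have [m dm mP] := base_fun_lower fC.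
have [f0 fc _ [x0 fx0] _] := (CalphaP _ _).1 fC.
apply/CalphaP; split.
- by move=> x; exact: symmetral_ge0.
- move=> x y l fx fy /[dup] l01 /andP[l0 l1].
  have step e : 0 < e -> exists2 v, v <= l * base (symmetral u f x) +
      (1 - l) * base (symmetral u f y) + e &
      0 < symmetral u f (l *: x + (1 - l) *: y) /\
      base (symmetral u f (l *: x + (1 - l) *: y)) <= v.
    move=> e0.
    have [p [q [fp fq xpq hx]]] := symmetral_approx fC u1 fx e0.
    have [p' [q' [fp' fq' ypq hy]]] := symmetral_approx fC u1 fy e0.
    have [fpp hpp] := fc _ _ _ fp fp' l01.
    have [fqq hqq] := fc _ _ _ fq fq' l01.
    have := symmetral_mem fC u1 fpp fqq.
    have -> : 2^-1 *: (l *: p + (1 - l) *: p' +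
        reflection u (l *: q + (1 - l) *: q')) = l *: x + (1 - l) *: y.
      rewrite reflectionD !reflectionZ xpq ypq !scalerDr !scalerA.
      by rewrite addrACA ![_ * 2^-1]mulrC.
    move=> [s0 sv]; eexists; last by split; [exact: s0|exact: sv].
    have := ler_wpM2l l0 (ltW hx); have l1' : 0 <= 1 - l by lra.
    have := ler_wpM2l l1' (ltW hy); lra.
  have [_ _ [s0 _]] := step 1 ltr01; split => //.
  apply/ler_addgt0Pr => e e0; have [v vv [_ /le_trans]] := step e e0; exact.
- by move=> x a; exact: symmetral_usc.
- by exists (2^-1 *: (x0 + reflection u x0)); have [] := symmetral_mem fC u1 fx0 fx0.
- move=> e e0; have [r rP] := base_fun_coercive (2 * (base e + 1) - m) fC.
  exists r => x rx; rewrite ltNge; apply/negP => ex.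
  have fx := lt_le_trans e0 ex.
  have [p [q [fp fq xpq hx]]] := symmetral_approx fC u1 fx ltr01.
  have xe : base (symmetral u f x) <= base e by rewrite le_base.
  have := mP _ fp; have := mP _ fq => mp mq.
  have pr : enorm p <= r by apply: rP => //; lra.
  have qr : enorm q <= r by apply: rP => //; lra.
  have := enormD p (reflection u q); rewrite enorm_reflection// => pq.
  by move: rx; rewrite xpq enormZ ger0_norm ?invr_ge0//; lra.
Qed.

End Symmetral.

(** * Iterated symmetrals and averages of support functions *)

Section IteratedSymmetral.
Context {R : realType} {n : nat}.
Variable alpha : R.
Implicit Types (f h : 'cV[R]_n -> R) (u x y z : 'cV[R]_n).

Local Notation base := (base alpha).

Definition symmetrals w f := foldl (fun f u => symmetral alpha u f) f w.

Lemma symmetrals_Calpha w f : rword w -> Calpha alpha f ->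
  Calpha alpha (symmetrals w f).
Proof.
elim: w f => [//|u w IH] f /word_cons[u1 ww] fC.
by apply: IH => //; exact: symmetral_Calpha.
Qed.

Lemma symmetrals_le (F : ('cV[R]_n -> R) -> R) w f :
  (forall f u, Calpha alpha f -> enorm u = 1 -> F f <= F (symmetral alpha u f)) ->
  rword w -> Calpha alpha f -> F f <= F (symmetrals w f).
Proof.
move=> Fle; elim: w f => [//|u w IH] f /word_cons[u1 ww] fC.
by apply: le_trans (Fle _ _ fC u1) _; apply: IH => //; exact: symmetral_Calpha.
Qed.

(** Reflections preserve each sphere, so an upper bound [h] of the conjugate on the single sphere of
    radius [r] is enough, even if the conjugate is infinite elsewhere. *)
Lemma symmetrals_fenchel w f h r : rword w -> Calpha alpha f ->
  (forall z y, 0 < f z -> enorm y = r -> dotv z y - base (f z) <= h y) ->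
  forall z y, 0 < symmetrals w f z -> enorm y = r ->
    dotv z y - base (symmetrals w f z) <= ravgs w h y.
Proof.
elim: w f h => [//|u w IH] f h /word_cons[u1 ww] fC fh.
apply: IH => //; first exact: symmetral_Calpha.
move=> z y fz yr; apply/ler_addgt0Pr => e e0.
have [p [q [fp fq zpq hz]]] := symmetral_approx fC u1 fz e0.
have := fh _ _ fp yr; have := fh q (reflection u y) fq.
rewrite enorm_reflection// => /(_ yr).
by rewrite {1}zpq dotvZl dotvDl dotv_reflection /avg; lra.
Qed.

(* [E] is a set of points of the epigraph of the base function of [f], lying
   over the ball of radius [r], whose support function is [h]. *)
Definition epi_support r f h (E : 'cV[R]_n -> R -> Prop) :=
  [/\ forall z v, E z v -> [/\ 0 < f z, base (f z) <= v & enorm z <= r],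
      forall y z v, E z v -> dotv z y - v <= h y &
      forall y e, 0 < e -> exists z v, E z v /\ h y - e < dotv z y - v].

(** The new set is the half-sum of [E] and its reflection: support functions are additive under such
    sums, and the ball of radius [r] is convex and reflection invariant. *)
Lemma symmetrals_epi_support r w f h : rword w -> Calpha alpha f ->
  (exists E, epi_support r f h E) ->
  exists E, epi_support r (symmetrals w f) (ravgs w h) E.
Proof.
elim: w f h => [//|u w IH] f h /word_cons[u1 ww] fC [E [Ef Eh hE]].
apply: IH => //; first exact: symmetral_Calpha.
exists (fun z v => exists z1 v1 z2 v2, [/\ E z1 v1, E z2 v2,
  z = 2^-1 *: (z1 + reflection u z2) & v = (v1 + v2) / 2]); split.
- move=> _ _ [z1 [v1 [z2 [v2 [E1 E2 -> ->]]]]].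
  have [f1 b1 r1] := Ef _ _ E1; have [f2 b2 r2] := Ef _ _ E2.
  have [fz bz] := symmetral_mem fC u1 f1 f2; split => //; first by lra.
  have := enormD z1 (reflection u z2); rewrite enorm_reflection//.
  by rewrite enormZ ger0_norm ?invr_ge0//; lra.
- move=> y _ _ [z1 [v1 [z2 [v2 [E1 E2 -> ->]]]]].
  have := Eh y _ _ E1; have := Eh (reflection u y) _ _ E2.
  by rewrite dotvZl dotvDl dotv_reflection /avg; lra.
- move=> y e e0; have [z1 [v1 [E1 h1]]] := hE y _ e0.
  have [z2 [v2 [E2 h2]]] := hE (reflection u y) _ e0.
  exists (2^-1 *: (z1 + reflection u z2)), ((v1 + v2) / 2); split.
    by exists z1, v1, z2, v2.
  by rewrite dotvZl dotvDl dotv_reflection /avg; lra.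
Qed.

(* The conjugate of the base function of [f] restricted to a ball; [r] must be
   large enough for the ball to meet the support of [f]. *)
Definition tsupp f r y : R :=
  sup [set dotv z y - base (f z) | z in [set z | 0 < f z /\ enorm z <= r]].

Section TruncatedSupport.
Variables (f : 'cV[R]_n -> R) (z0 : 'cV[R]_n).
Hypotheses (fC : Calpha alpha f) (fz0 : 0 < f z0).

Lemma tsupp_has_sup r y : enorm z0 <= r -> has_sup
  [set dotv z y - base (f z) | z in [set z | 0 < f z /\ enorm z <= r]].
Proof.
move=> z0r; have [m _ mP] := base_fun_lower fC.
split; first by exists (dotv z0 y - base (f z0)), z0.
exists (r * enorm y - m) => _ [z [fz zr] <-].
have := mP _ fz; have := dotv_le z y.
have := ler_wpM2r (enorm_ge0 y) zr; lra.
Qed.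

Lemma tsupp_ub r y z : 0 < f z -> enorm z <= r ->
  dotv z y - base (f z) <= tsupp f r y.
Proof.
move=> fz zr; have [m _ mP] := base_fun_lower fC.
apply: ub_le_sup; last by exists z.
exists (r * enorm y - m) => _ [z' [fz' zr'] <-].
have := mP _ fz'; have := dotv_le z' y.
have := ler_wpM2r (enorm_ge0 y) zr'; lra.
Qed.

Lemma tsupp_adherent r y e : enorm z0 <= r -> 0 < e -> exists z,
  [/\ 0 < f z, enorm z <= r & tsupp f r y - e < dotv z y - base (f z)].
Proof.
move=> z0r e0; have [_ [z [fz zr] <-] ze] := sup_adherent e0 (tsupp_has_sup y z0r).
by exists z.
Qed.

Lemma tsupp_le r y c : enorm z0 <= r ->
  (forall z, 0 < f z -> enorm z <= r -> dotv z y - base (f z) <= c) ->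
  tsupp f r y <= c.
Proof.
move=> z0r h; apply: ge_sup; first exact: (tsupp_has_sup y z0r).1.
by move=> _ [z [fz zr] <-]; exact: h.
Qed.

Lemma tsupp_mono r r' y : enorm z0 <= r -> r <= r' -> tsupp f r y <= tsupp f r' y.
Proof.
move=> z0r rr'; apply: tsupp_le => // z fz zr.
by apply: tsupp_ub => //; exact: le_trans rr'.
Qed.

Lemma tsupp_lipschitz r : enorm z0 <= r -> lipschitz r (tsupp f r).
Proof.
move=> z0r x y; rewrite lerBlDr; apply: tsupp_le => // z fz zr.
have := tsupp_ub y fz zr; have := dotv_le z (x - y); rewrite dotvBr.
have := ler_wpM2r (enorm_ge0 (x - y)) zr; lra.
Qed.

Lemma tsupp_convex r x y l : enorm z0 <= r -> 0 <= l <= 1 ->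
  tsupp f r (l *: x + (1 - l) *: y) <= l * tsupp f r x + (1 - l) * tsupp f r y.
Proof.
move=> z0r /andP[l0 l1]; apply: tsupp_le => // z fz zr.
have l1' : 0 <= 1 - l by lra.
have := ler_wpM2l l0 (tsupp_ub x fz zr); have := ler_wpM2l l1' (tsupp_ub y fz zr).
by rewrite dotvDr !dotvZr; lra.
Qed.

Lemma tsupp_epi_support r : enorm z0 <= r -> exists E, epi_support r f (tsupp f r) E.
Proof.
move=> z0r; exists (fun z v => [/\ 0 < f z, enorm z <= r & v = base (f z)]); split.
- by move=> z v [fz zr ->].
- by move=> y z v [fz zr ->]; exact: tsupp_ub.
- move=> y e e0; have [z [fz zr hz]] := tsupp_adherent y z0r e0.
  by exists z, (base (f z)).
Qed.

End TruncatedSupport.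

End IteratedSymmetral.

(** * Means over the orthogonal group *)

Section Mean.
Context {R : realType} {n : nat}.
Variable eta : probability (mxborel R n) R.
Hypothesis heta : is_haar eta.

Local Notation On := (orthogonal_group R n).
Local Notation rlip := (@rownorm_lipschitz R n).

Lemma near_entries (t : 'M[R]_n) d (P : 'M[R]_n -> Prop) : 0 < d ->
  (forall s : 'M[R]_n, (forall i j, `|s i j - t i j| <= d) -> P s) -> \forall s \near t, P s.
Proof.
move=> d0 dP; apply/nbhs_ballP; exists d => //= s [_ ts]; apply: dP => i j.
by rewrite distrC ltW//; exact: (ts i j).
Qed.

Lemma near_rownorm (t : 'M[R]_n) e : 0 < e ->
  \forall s \near t, rownorm (s^T - t^T) <= e /\ rownorm (t^T - s^T) <= e.
Proof.
move=> e0; apply: (@near_entries _ (e / n.+1%:R / n.+1%:R)) => [|s st].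
  by rewrite !divr_gt0.
have se : rownorm (s^T - t^T) <= e.
  by apply: (rownorm_le_coord (ltW e0)) => i j; have := st j i; rewrite !mxE.
by split; rewrite // -rownormN opprB.
Qed.

Lemma continuous_measurable_mx (g : 'M[R]_n -> R) : continuous g ->
  measurable_fun setT (g : mxborel R n -> R).
Proof.
move=> /continuousP cg; apply: (measurability _ (RGenOpens.measurableE R)).
move=> _ [_ [a [b ->]] <-]; rewrite setTI; apply: sub_sigma_algebra.
exact/cg/interval_open.
Qed.

Lemma rownorm_lipschitz_measurable C H : 0 <= C -> rlip C H ->
  measurable_fun setT (fun t : mxborel R n => H t^T).
Proof.
move=> C0 HC; apply: (@continuous_measurable_mx (fun t => H t^T)) => t.
apply/(@cvgrPdist_le _ _ _ _ (nbhs_filter t)) => e e0; have C1 : 0 < C + 1 by lra.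
have d0 : 0 < e / (C + 1) by rewrite divr_gt0.
have Ce : C * (e / (C + 1)) <= e by rewrite mulrCA ger_pMr// ler_pdivrMr//; lra.
have := near_rownorm t d0; apply: (@filterS _ (nbhs t) (nbhs_filter t)) => s [st ts].
have := HC s^T t^T; have := HC t^T s^T.
have := ler_wpM2l C0 st; have := ler_wpM2l C0 ts; rewrite ler_norml; lra.
Qed.

(** Orthogonality amounts to finitely many equations on the inner products of columns. *)
Lemma orthogonal_measurable : measurable (On : set (mxborel R n)).
Proof.
have mc i j : measurable_fun setT (fun t : mxborel R n => (t : 'M[R]_n) i j).
  exact: (continuous_measurable_mx (@coord_continuous R n n i j)).
pose G i j (t : mxborel R n) := \sum_k (t : 'M[R]_n) k i * (t : 'M[R]_n) k j.
have -> : On = \big[setI/setT]_(p : 'I_n * 'I_n)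
    (G p.1 p.2 @^-1` [set (p.1 == p.2)%:R]).
  rewrite -bigcap_seq; apply/seteqP; split => [t tt p _ /=|t tG].
    have /matrixP/(_ p.1 p.2) := tt; rewrite !mxE => <-.
    by apply: eq_bigr => k _; rewrite mxE.
  apply/matrixP => i j; rewrite !mxE.
  have /= <- := tG (i, j) (mem_index_enum _).
  by apply: eq_bigr => k _; rewrite mxE.
apply: bigsetI_measurable => p _.
rewrite -[X in measurable X]setTI; have mG : measurable_fun setT (G p.1 p.2).
  by apply: measurable_sum => k; apply: measurable_funM.
by apply: mG => //; exact: measurable_set1.
Qed.

Lemma measurable_mulmx (rho : 'M[R]_n) : On rho ->
  measurable_fun setT (fun t : mxborel R n => (rho *m t : mxborel R n)).
Proof.
move=> rr; apply: (@measurability _ _ (mxborel R n) (mxborel R n) setT _ (@open 'M[R]_n) erefl).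
move=> _ [U oU <-]; rewrite setTI; apply: sub_sigma_algebra.
rewrite openE => t Ut; have /nbhs_ballP[e /= e0 eU] := open_nbhs_nbhs (conj oU Ut).
have n1 : 0 < n.+1%:R :> R by rewrite ltr0Sn.
apply: (@near_entries _ (e / 2 / n.+1%:R)) => [|s st]; first by rewrite !divr_gt0.
apply: eU; split => // i j; rewrite /ball /= distrC.
apply: (@le_lt_trans _ _ (e / 2)); last by rewrite ltr_pdivrMr// ltr_pMr// ltr1n.
have -> : (rho *m s) i j - (rho *m t) i j = (rho *m (col j (s - t))) i 0.
  by rewrite colE mulmxA -colE mulmxBr !mxE.
apply: le_trans (coord_le_enorm _ _) _; rewrite enorm_orthogonal//.
apply: (@le_trans _ _ (n%:R * (e / 2 / n.+1%:R))).
  by apply: enorm_le_coord => k; have := st k j; rewrite !mxE.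
by rewrite mulrCA ger_pMr ?divr_gt0// ler_pdivrMr// mul1r ler_nat.
Qed.

(** On O(n) the transpose is the inverse appearing in [is_psi_sym]. *)
Definition haar_mean (H : 'M[R]_n -> R) : R := \int[eta]_(t in On) H t^T.

Lemma rownorm_lipschitz_integrable C H : 0 <= C -> rlip C H ->
  eta.-integrable On (EFin \o (fun t => H t^T)).
Proof.
move=> C0 HC; apply: measurable_bounded_integrable.
- exact: orthogonal_measurable.
- exact: (le_lt_trans (probability_le1 eta orthogonal_measurable) (ltry 1)).
- by apply: measurable_funTS; exact: (rownorm_lipschitz_measurable C0 HC).
(* Orthogonal matrices have entries of absolute value at most 1, hence [rownorm] at most
   [n.+1%:R ^+ 2]. *)
exists (`|H 0| + C * n.+1%:R ^+ 2); split; first exact: num_real.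
move=> M MH t tt /=.
have tb : rownorm t^T <= n.+1%:R ^+ 2.
  apply: rownorm_le_coord => [|i j]; first by rewrite exprn_ge0.
  have -> : n.+1%:R ^+ 2 / n.+1%:R / n.+1%:R = 1 :> R by field; rewrite nat1r pnatr_eq0.
  by rewrite mxE; exact: orthogonal_coord.
have := HC t^T 0; have := HC 0 t^T; rewrite subr0 sub0r rownormN.
have := ler_wpM2l C0 tb; have := ler_norm (H 0); have := ler_norm (- H 0).
rewrite normrN ler_norml; lra.
Qed.

(** Monotonicity, linearity and total mass one are packed into one inequality. The coefficients may
    be negative, so equalities of means follow from two uses. *)
Lemma haar_mean_le C C1 C2 H H1 H2 l1 l2 c : 0 <= C -> 0 <= C1 -> 0 <= C2 ->
  rlip C H -> rlip C1 H1 -> rlip C2 H2 ->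
  (forall t, On t -> H t <= l1 * H1 t + l2 * H2 t + c) ->
  haar_mean H <= l1 * haar_mean H1 + l2 * haar_mean H2 + c.
Proof.
move=> C0 C10 C20 HC HC1 HC2 HH; have mO := orthogonal_measurable.
have i0 := rownorm_lipschitz_integrable C0 HC.
have i1 := rownorm_lipschitz_integrable C10 HC1.
have i2 := rownorm_lipschitz_integrable C20 HC2.
have j1 : eta.-integrable On (EFin \o (fun t => l1 * H1 t^T)).
    exact: (integrableZl mO l1 i1).
have j2 : eta.-integrable On (EFin \o (fun t => l2 * H2 t^T)).
    exact: (integrableZl mO l2 i2).
have j3 : eta.-integrable On (EFin \o (fun t => l1 * H1 t^T + l2 * H2 t^T)).
  exact: (integrableD mO j1 j2).
have jc : eta.-integrable On (EFin \o (fun=> c)).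
  by apply: finite_measure_integrable_cst.
have -> : l1 * haar_mean H1 + l2 * haar_mean H2 + c =
    \int[eta]_(t in On) (l1 * H1 t^T + l2 * H2 t^T + c).
  rewrite RintegralD// RintegralD// !RintegralZl//.
  rewrite Rintegral_cst//.
  have -> : fine (eta On) = 1 by have -> := heta.1.
  by rewrite mulr1.
apply: le_Rintegral => //; first exact: (integrableD mO j3 jc).
by move=> t tt; apply: HH; exact: orthogonal_trmx.
Qed.

(** Substituting [v^T *m t] for [t] turns [H t^T] into [H (t^T *m v)], so left invariance of [eta]
    becomes invariance under right multiplication. *)
Lemma haar_mean_mulr C H v : 0 <= C -> rlip C H -> On v ->
  haar_mean (fun t => H (t *m v)) = haar_mean H.
Proof.
move=> C0 HC vv; have vt := orthogonal_trmx vv; have mO := orthogonal_measurable.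
have mv := measurable_mulmx vt.
have preO : (fun t : mxborel R n => v^T *m t) @^-1` On = On.
  apply/seteqP; split => t /= tt; last exact: orthogonal_mul.
  have := orthogonal_mul vv tt; have [_ vvt] := orthogonalP vv.
  by rewrite mulmxA vvt mul1mx.
rewrite /haar_mean /Rintegral; congr fine.
transitivity (\int[pushforward eta (fun t : mxborel R n => (v^T *m t : mxborel R n))]_(t in On)
    (H t^T)%:E)%E.
  rewrite integral_pushforward//.
  - rewrite preO; apply: eq_integral => t _ /=.
    by rewrite trmx_mul trmxK.
  - by apply/measurable_EFinP; exact: (rownorm_lipschitz_measurable C0 HC).
  - rewrite preO.
    have HvC : rlip C (fun t => H (t *m v)).
      by move=> t s; have := HC (t *m v) (s *m v); rewrite -mulmxBl rownorm_mulmx.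
    have := rownorm_lipschitz_integrable C0 HvC.
    by congr (integrable _ _ _); apply/funext => t /=; rewrite trmx_mul trmxK.
apply: eq_measure_integral => A mA _; rewrite /pushforward.
rewrite -[RHS](heta.2 v A)//=; congr (eta _).
have [v1 v2] := orthogonalP vv.
apply/seteqP; split => [t /= tA|_ [s sA <-] /=].
  by exists (v^T *m t) => //; rewrite mulmxA v2 mul1mx.
by rewrite mulmxA v1 mul1mx.
Qed.

(* Right averages of [H] are almost constant and have the same mean as [H];
   that constant is unchanged when [H] is translated on the left. *)
Lemma haar_mean_mull L h x rho : 0 <= L -> lipschitz L h -> On rho ->
  haar_mean (fun t => h (rho *m (t *m x))) <= haar_mean (fun t => h (t *m x)).
Proof.
move=> L0 hL rr; pose act := (fun v t : 'M[R]_n => t *m v).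
pose C := L * (n%:R * enorm x); have C0 : 0 <= C by rewrite !mulr_ge0 ?enorm_ge0.
have keep w H : word On w -> rlip C H ->
    rlip C (avgs act w H) /\ haar_mean (avgs act w H) = haar_mean H.
  elim: w H => [//|v w IH] H /word_cons[vv ww] HC.
  have HC' := rownorm_lipschitz_avg vv HC.
  have HvC : rlip C (fun t => H (t *m v)).
    by move=> t s; have := HC (t *m v) (s *m v); rewrite -mulmxBl rownorm_mulmx.
  have [r1 r2] := IH _ ww HC'; split => //; rewrite /= r2.
  have e1 := @haar_mean_le C C C _ H (fun t => H (t *m v)) 2^-1 2^-1 0 C0 C0 C0 HC' HC HvC.
  have e2 := @haar_mean_le C C C H _ (fun t => H (t *m v)) 2 (-1) 0 C0 C0 C0 HC HC' HvC.
  rewrite !(haar_mean_mulr C0 HC vv) in e1 e2.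
  have /e1 {}e1 : forall t, On t -> avg act v H t <= 2^-1 * H t + 2^-1 * H (t *m v) + 0.
    by move=> t _; rewrite /avg /act; lra.
  have /e2 {}e2 : forall t, On t -> H t <= 2 * avg act v H t + (-1) * H (t *m v) + 0.
    by move=> t _; rewrite /avg /act; lra.
  by apply/eqP; rewrite eq_le; apply/andP; split; lra.
apply/ler_addgt0Pr => e e0.
have [w ww osc] := right_equalize x L0 e0 hL.
have hrL : lipschitz L (fun y => h (rho *m y)).
  by move=> y z; have := hL (rho *m y) (rho *m z); rewrite -mulmxBr enorm_orthogonal.
have HC := lipschitz_orbit x L0 hL; have HrC := lipschitz_orbit x L0 hrL.
have [r1 r2] := keep w _ ww HC; have [s1 s2] := keep w _ ww HrC.
rewrite -r2 -s2.
(* Left translation commutes with averaging along right multiplications. *)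
have sh (H : 'M[R]_n -> R) t : avgs act w (fun t => H (rho *m t)) t = avgs act w H (rho *m t).
  elim: w H {ww osc r1 r2 s1 s2} t => [//|v w IH] H t /=.
  by rewrite -IH; congr (avgs _ _ _ _); apply/funext => s; rewrite /avg /act mulmxA.
have := @haar_mean_le C C C _ _ _ 1 0 e C0 C0 C0 s1 r1 r1.
rewrite mul1r mul0r addr0; apply=> t tt.
have -> : (fun t => h (rho *m (t *m x))) = (fun t => (fun t => h (t *m x)) (rho *m t)).
  by apply/funext => s; rewrite mulmxA.
rewrite (sh (fun t => h (t *m x))); have := osc (rho *m t) t (orthogonal_mul rr tt) tt.
by rewrite -/act; lra.
Qed.

End Mean.

Section RotationMean.
Context {R : realType} {n : nat}.
Variable eta : probability (mxborel R n) R.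
Hypothesis heta : is_haar eta.
Hypothesis n0 : (0 < n)%N.
Implicit Types (h : 'cV[R]_n -> R) (L : R).

Definition rotation_mean h x : R := haar_mean eta (fun t => h (t *m x)).

Local Notation mean := rotation_mean.

Lemma rotation_mean_le L h h1 h2 x y z l1 l2 c : 0 <= L ->
  lipschitz L h -> lipschitz L h1 -> lipschitz L h2 ->
  (forall t, orthogonal_group R n t ->
    h (t *m x) <= l1 * h1 (t *m y) + l2 * h2 (t *m z) + c) ->
  mean h x <= l1 * mean h1 y + l2 * mean h2 z + c.
Proof.
move=> L0 hL h1L h2L; apply: (haar_mean_le heta); last 3 first.
- exact: (lipschitz_orbit x L0 hL).
- exact: (lipschitz_orbit y L0 h1L).
- exact: (lipschitz_orbit z L0 h2L).
all: by rewrite !mulr_ge0 ?enorm_ge0.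
Qed.

Lemma rotation_mean_ub L h x c : 0 <= L -> lipschitz L h ->
  (forall y, sphere (enorm x) y -> h y <= c) -> mean h x <= c.
Proof.
move=> L0 hL hc; have := @rotation_mean_le L h h h x x x 0 0 c L0 hL hL hL.
rewrite !mul0r !add0r; apply=> t tt.
by rewrite !mul0r !add0r; apply: hc; rewrite /sphere /= enorm_orthogonal.
Qed.

Lemma rotation_mean_lb L h x c : 0 <= L -> lipschitz L h ->
  (forall y, sphere (enorm x) y -> c <= h y) -> c <= mean h x.
Proof.
(* With both coefficients 1, the pointwise bound [h <= h + h - c] integrates to a mean at most twice
   itself minus [c]. *)
move=> L0 hL hc; have := @rotation_mean_le L h h h x x x 1 1 (- c) L0 hL hL hL.
rewrite !mul1r => h2.
suff hh t : orthogonal_group R n t -> h (t *m x) <= 1 * h (t *m x) + 1 * h (t *m x) - c.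
  by have := h2 hh; lra.
move=> tt; have : c <= h (t *m x) by apply: hc; rewrite /sphere /= enorm_orthogonal.
lra.
Qed.

Lemma rotation_mean_mono L h h' x : 0 <= L -> lipschitz L h -> lipschitz L h' ->
  (forall y, h y <= h' y) -> mean h x <= mean h' x.
Proof.
move=> L0 hL hL' hh; have := @rotation_mean_le L h h' h' x x x 1 0 0 L0 hL hL' hL'.
by rewrite mul0r mul1r !addr0; apply=> t _; rewrite mul0r mul1r !addr0.
Qed.

Lemma rotation_mean_lipschitz L h : 0 <= L -> lipschitz L h -> lipschitz L (mean h).
Proof.
move=> L0 hL x y.
have := @rotation_mean_le L h h h x y y 1 0 (L * enorm (x - y)) L0 hL hL hL.
rewrite mul0r mul1r addr0 => h2; rewrite lerBlDl; apply: h2 => t tt.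
rewrite mul0r mul1r addr0; have := hL (t *m x) (t *m y).
by rewrite -mulmxBr enorm_orthogonal//; lra.
Qed.

Lemma rotation_mean_convex L h x y l : 0 <= L -> lipschitz L h ->
  (forall x y, h (l *: x + (1 - l) *: y) <= l * h x + (1 - l) * h y) ->
  mean h (l *: x + (1 - l) *: y) <= l * mean h x + (1 - l) * mean h y.
Proof.
move=> L0 hL hc; have := @rotation_mean_le L h h h (l *: x + (1 - l) *: y) x y l (1 - l) 0 L0 hL hL hL.
rewrite addr0; apply=> t _; rewrite mulmxDr -!scalemxAr addr0; exact: hc.
Qed.

Lemma rotation_mean_radial L h x y : 0 <= L -> lipschitz L h ->
  enorm x = enorm y -> mean h x = mean h y.
Proof.
move=> L0 hL xy; have [v vv vxy] := radial_orthogonal n0 xy.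
have C0 : 0 <= L * (n%:R * enorm x) by rewrite !mulr_ge0 ?enorm_ge0.
rewrite /mean -(haar_mean_mulr heta C0 (lipschitz_orbit x L0 hL) vv).
by congr haar_mean; apply/funext => t; rewrite -mulmxA vxy.
Qed.

(** The reflection acts on [t *m x] from the left, which is where [haar_mean_mull] enters. Its
    one-sided inequality suffices because the reflection is an involution. *)
Lemma rotation_mean_avg L h u x : 0 <= L -> lipschitz L h -> enorm u = 1 ->
  mean (avg reflection u h) x = mean h x.
Proof.
move=> L0 hL u1; have rr := orthogonal_reflection u1.
have rL : lipschitz L (fun y => h (reflection u y)).
  by move=> y z; have := hL (reflection u y) (reflection u z);
    rewrite -reflectionB enorm_reflection.
have aL := lipschitz_avg u1 hL.
have E : mean (fun y => h (reflection u y)) x = mean h x.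
  have := haar_mean_mull heta x L0 hL rr.
  have := haar_mean_mull heta x L0 rL rr.
  have -> : (fun t => h (reflection_mx u *m (t *m x))) = (fun t => h (reflection u (t *m x))).
    by apply/funext => t; rewrite reflection_mxE.
  have -> : (fun t => h (reflection u (reflection_mx u *m (t *m x)))) = (fun t => h (t *m x)).
    by apply/funext => t; rewrite reflection_mxE reflectionK.
  by move=> a b; apply/eqP; rewrite eq_le a b.
apply/eqP; rewrite eq_le; apply/andP; split.
  have := @rotation_mean_le L _ _ _ x x x 2^-1 2^-1 0 L0 aL hL rL.
  rewrite E => h2.
  have hh : forall t, orthogonal_group R n t -> avg reflection u h (t *m x) <=
      2^-1 * h (t *m x) + 2^-1 * h (reflection u (t *m x)) + 0.
    by move=> t _; rewrite /avg; lra.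
  by have := h2 hh; lra.
have := @rotation_mean_le L _ _ _ x x x 2 (-1) 0 L0 hL aL rL.
rewrite E => h2.
have hh : forall t, orthogonal_group R n t -> h (t *m x) <=
    2 * avg reflection u h (t *m x) + (-1) * h (reflection u (t *m x)) + 0.
  by move=> t _; rewrite /avg; lra.
by have := h2 hh; lra.
Qed.

Lemma rotation_mean_ravgs L w h x : 0 <= L -> lipschitz L h -> rword w ->
  mean (ravgs w h) x = mean h x.
Proof.
move=> L0; elim: w h => [//|u w IH] h hL /word_cons[u1 ww].
rewrite [ravgs _ _]/(ravgs w (avg reflection u h)) IH//; last exact: lipschitz_avg.
exact: rotation_mean_avg hL u1.
Qed.

(** Averaging along a word keeps the mean, and the mean of a function lies between its extreme
    values on the sphere. *)
Lemma ravgs_near_mean L w h x e : 0 <= L -> lipschitz L h -> rword w ->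
  (forall y z, enorm y = enorm x -> enorm z = enorm x -> ravgs w h y - ravgs w h z <= e) ->
  `|ravgs w h x - mean h x| <= e.
Proof.
move=> L0 hL ww osc; have wL := lipschitz_ravgs ww hL.
rewrite -(rotation_mean_ravgs x L0 hL ww).
have h1 : mean (ravgs w h) x <= ravgs w h x + e.
  by apply: (rotation_mean_ub L0 wL) => y yx; have := osc _ x yx erefl; lra.
have h2 : ravgs w h x - e <= mean (ravgs w h) x.
  by apply: (rotation_mean_lb L0 wL) => y yx; have := osc x _ erefl yx; lra.
rewrite ler_norml; lra.
Qed.

Lemma exists_symmetrizing_words (h : nat -> 'cV[R]_n -> R) (L : nat -> R) :
  (forall i j, (i <= j)%N -> L i <= L j) -> (forall j, 0 < L j) ->
  (forall j, lipschitz (L j) (h j)) ->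
  exists w : nat -> seq 'cV[R]_n, forall k, rword (w k) /\
    forall j x, (j <= k)%N -> enorm x <= k%:R ->
      `|ravgs (w k) (h j) x - mean (h j) x| <= k.+1%:R^-1.
Proof.
move=> Lm L0 hL.
suff /choice[w wP] : forall k, exists w, rword w /\
    forall j x, (j <= k)%N -> enorm x <= k%:R ->
      `|ravgs w (h j) x - mean (h j) x| <= k.+1%:R^-1.
  by exists w.
(* Capping the index at [k] gives all functions the common Lipschitz constant [L k]. *)
move=> k; pose g j := h (minn j k).
have gL j : lipschitz (L k) (g j).
  move=> x y; apply: le_trans (hL (minn j k) x y) _.
  by rewrite ler_wpM2r ?enorm_ge0// Lm// geq_minr.
have k0 : 0 < k.+1%:R^-1 :> R by rewrite invr_gt0 ltr0Sn.
have [w ww wP] := ravgs_equalize_ball k.+1 k%:R n0 (L0 k) k0 gL.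
exists w; split => // j x jk xk.
have gj : g j = h j by rewrite /g (minn_idPl jk).
rewrite -gj; apply: (ravgs_near_mean (ltW (L0 k)) (gL j) ww) => y z yx zx.
by apply: wP => //; rewrite ?yx ?zx// ltnS.
Qed.

End RotationMean.

(** * Truncated conjugates *)

Section LegendreMean.
Context {R : realType} {n : nat}.
Variable eta : probability (mxborel R n) R.
Hypothesis heta : is_haar eta.
Variables (alpha : R) (f : 'cV[R]_n -> R) (z0 : 'cV[R]_n).
Hypotheses (fC : Calpha alpha f) (fz0 : 0 < f z0).

Local Notation base := (base alpha).
Local Notation On := (orthogonal_group R n).

(** Every ball contains the support point [z0], so no truncated conjugate is a supremum over the
    empty set; the successor keeps the radius positive. *)
Definition radius j : R := enorm z0 + j.+1%:R.

Lemma radius_gt0 j : 0 < radius j.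
Proof. by rewrite ltr_wpDl ?enorm_ge0. Qed.

Lemma radius_ge j : enorm z0 <= radius j.
Proof. by rewrite lerDl. Qed.

Lemma radius_mono i j : (i <= j)%N -> radius i <= radius j.
Proof. by move=> ij; rewrite lerD2l ler_nat ltnS. Qed.

Definition hconj j := tsupp alpha f (radius j).

Lemma hconj_lipschitz j : lipschitz (radius j) (hconj j).
Proof. exact: (tsupp_lipschitz fC fz0 (radius_ge j)). Qed.

Lemma hconj_mono i j y : (i <= j)%N -> hconj i y <= hconj j y.
Proof.
by move=> ij; apply: (tsupp_mono fC fz0); [exact: radius_ge|exact: radius_mono].
Qed.

Lemma hconj_ub z y : 0 < f z -> exists j, dotv z y - base (f z) <= hconj j y.
Proof.
move=> fz; exists (Num.truncn (enorm z)); apply: (tsupp_ub fC) => //.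
have := Num.Theory.truncnS_gt (enorm z); have := enorm_ge0 z0; rewrite /radius; lra.
Qed.

Lemma legendre_cvg y :
  (hconj j y)%:E @[j --> \oo] --> legendre (base_fun alpha f) y.
Proof.
suff -> : legendre (base_fun alpha f) y = ereal_sup (range (fun j => (hconj j y)%:E)).
  by apply: ereal_nondecreasing_cvgn => i j ij; rewrite lee_fin hconj_mono.
apply/eqP; rewrite eq_le; apply/andP; split; apply: ge_ereal_sup.
  move=> _ [z _ <-].
  have [f0 _ _ _ _] := (CalphaP _ _).1 fC.
  case: (ge0_cases (f0 z)) => [fz|fz]; first by rewrite base_fun0// leNye.
  rewrite base_funE//; have [j hj] := hconj_ub y fz.
  have le1 : ((hconj j y)%:E <= ereal_sup (range (fun j => (hconj j y)%:E)))%E.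
    by apply: ereal_sup_ubound; exists j.
  by apply: le_trans le1; rewrite -EFinB lee_fin dotvC.
move=> _ [j _ <-]; have [E [Ef _ hE]] := tsupp_epi_support fC fz0 (radius_ge j).
apply/lee_addgt0Pr => e e0; have [z [v [/Ef[fz vz _]]]] := hE y _ e0.
have le1 : ((dotv y z)%:E - base_fun alpha f z <= legendre (base_fun alpha f) y)%E.
  by apply: ereal_sup_ubound; exists z.
move=> hz; apply: le_trans (leeD2r _ le1).
by rewrite base_funE// -EFinB -EFinD lee_fin dotvC /hconj; lra.
Qed.

End LegendreMean.

(** * Shifting integrals of functions bounded below *)

Section IntegralBoundedBelow.
Context d (T : measurableType d) (R : realType)
  (mu : {measure set T -> \bar R}).
Local Open Scope ereal_scope.

(** Since [g] may have integral +oo, linearity for integrable functions does not apply. Instead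
    [(g + K) + g^\- = g^\+ + K] is integrated with nonnegative terms, and the integral of [g^\-],
    which is at most [K], is subtracted. *)
Lemma integral_shift (D : set T) (g : T -> \bar R) (K : R) :
  measurable D -> mu D = 1 -> measurable_fun D g -> (0 <= K)%R ->
  (forall t, D t -> (- K)%:E <= g t) ->
  \int[mu]_(t in D) (g t + K%:E) = \int[mu]_(t in D) g t + K%:E.
Proof.
move=> mD mu1 mg K0 gK.
have mp : measurable_fun D g^\+ by exact: measurable_funepos.
have mn : measurable_fun D g^\- by exact: measurable_funeneg.
have gK0 t : D t -> 0 <= g t + K%:E.
  move=> /gK; case: (g t) => [r| |]//; last by rewrite addye ?leey.
  by rewrite -EFinD !lee_fin; lra.
have split_eq : \int[mu]_(t in D) (g t + K%:E) + \int[mu]_(t in D) g^\- t =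
    \int[mu]_(t in D) g^\+ t + K%:E.
  have {2}-> : K%:E = \int[mu]_(t in D) (cst K%:E t).
    by rewrite integral_cst// mu1 mule1.
  have mgK : measurable_fun D (fun t => g t + K%:E).
    by apply: emeasurable_funD => //; exact: measurable_cst.
  rewrite -(ge0_integralD mu mD gK0 mgK (fun t _ => funeneg_ge0 g t) mn).
  rewrite -(ge0_integralD mu mD (fun t _ => funepos_ge0 g t) mp)//.
  apply: eq_integral => t; rewrite inE => /gK.
  rewrite funeposE funenegE; case: (g t) => [r| |] //=.
    move=> _; have [r0|/ltW r0] := leP 0%R r.
      have -> : maxe (- r%:E) 0 = 0 by apply/max_idPr; rewrite -EFinN lee_fin oppr_le0.
      have -> : maxe r%:E 0 = r%:E by apply/max_idPl; rewrite lee_fin.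
      by rewrite adde0.
    have -> : maxe (- r%:E) 0 = (- r)%:E.
      by apply/max_idPl; rewrite -EFinN lee_fin oppr_ge0.
    have -> : maxe r%:E 0 = 0 by apply/max_idPr; rewrite lee_fin.
    by rewrite add0e -!EFinD; congr EFin; lra.
  by move=> _; rewrite maxye maxNye.
have nK : \int[mu]_(t in D) g^\- t <= K%:E.
  have -> : K%:E = \int[mu]_(t in D) (cst K%:E t) by rewrite integral_cst// mu1 mule1.
  apply: ge0_le_integral => // t Dt.
  rewrite funenegE ge_max lee_fin K0 andbT.
  by rewrite leeNl -EFinN gK.
have n0 : 0 <= \int[mu]_(t in D) g^\- t by apply: integral_ge0.
rewrite [in RHS]integralE.
move: split_eq nK n0.
case: (\int[mu]_(t in D) g^\- t) => [N| |]//.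
case: (\int[mu]_(t in D) (g t + K%:E)) => [B| |]//; case: (\int[mu]_(t in D) g^\+ t) => [P| |]//.
by move=> [] h _ _; rewrite -EFinN -!EFinD; congr EFin; lra.
Qed.

End IntegralBoundedBelow.

(** * Convergence of the means of the truncated conjugates *)

Section MeanConvergence.
Context {R : realType} {n : nat}.
Variable eta : probability (mxborel R n) R.
Hypothesis heta : is_haar eta.
Variables (alpha : R) (f : 'cV[R]_n -> R) (z0 : 'cV[R]_n).
Hypotheses (fC : Calpha alpha f) (fz0 : 0 < f z0).
Local Notation On := (orthogonal_group R n).
Local Notation hconj := (hconj alpha f z0).
Local Notation radius := (radius z0).

(** This is monotone convergence after a shift by [K], minus a lower bound of [hconj 0], hence of
    all [hconj j], on the sphere through [x]. *)
Lemma rotation_mean_cvg x : (rotation_mean eta (hconj j) x)%:E @[j --> \oo] -->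
  (\int[eta]_(t in On) legendre (base_fun alpha f) (invmx t *m x))%E.
Proof.
have mO : measurable (On : set (mxborel R n)) := orthogonal_measurable.
pose g (t : mxborel R n) := legendre (base_fun alpha f) ((t : 'M[R]_n)^T *m x).
have -> : (\int[eta]_(t in On) legendre (base_fun alpha f) (invmx t *m x) =
    \int[eta]_(t in On) g t)%E.
  by apply: eq_integral => t; rewrite inE => tt; rewrite orthogonal_invmx.
pose K := `|hconj 0 0| + radius 0 * enorm x.
have r0 : 0 <= radius 0 := ltW (radius_gt0 _ _).
have K0 : 0 <= K by rewrite addr_ge0// mulr_ge0// enorm_ge0.
have hK j t : On t -> - K <= hconj j (t^T *m x).
  move=> tt; have := hconj_mono fC fz0 (t^T *m x) (leq0n j).
  have := hconj_lipschitz fC fz0 0 0 (t^T *m x).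
  rewrite sub0r enormN enorm_orthogonal; last exact: orthogonal_trmx.
  by have := ler_norm (- hconj 0 0); rewrite normrN /K; lra.
have C0 j : 0 <= radius j * (n%:R * enorm x).
  by rewrite !mulr_ge0 ?enorm_ge0// ltW// radius_gt0.
have HC j := lipschitz_orbit x (ltW (radius_gt0 z0 j)) (hconj_lipschitz fC fz0 j).
have mh j : measurable_fun (On : set (mxborel R n))
    (fun t : mxborel R n => (hconj j ((t : 'M[R]_n)^T *m x))%:E).
  apply/measurable_EFinP; apply: measurable_funTS.
  exact: (rownorm_lipschitz_measurable (C0 j) (HC j)).
have cg t : (hconj j ((t : 'M[R]_n)^T *m x))%:E @[j --> \oo] --> g t.
  exact: legendre_cvg.
have mg : measurable_fun (On : set (mxborel R n)) g.
  by apply: (emeasurable_fun_cvg (fun j (t : mxborel R n) =>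
    (hconj j ((t : 'M[R]_n)^T *m x))%:E) g mh) => t _; exact: cg.
have gK t : On t -> ((- K)%:E <= g t)%E.
  move=> tt; rewrite -(cvg_lim _ (cg t))//; apply: lime_ge.
    by apply: cvgP; exact: cg.
  by apply: nearW => j; rewrite lee_fin hK.
pose G j (t : mxborel R n) := ((hconj j ((t : 'M[R]_n)^T *m x))%:E + K%:E)%E.
have etaO : (eta : {measure set (mxborel R n) -> \bar R}) On = 1%E := heta.1.
have shift (u : mxborel R n -> \bar R) : measurable_fun (On : set (mxborel R n)) u ->
    (forall t, On t -> ((- K)%:E <= u t)%E) ->
    (\int[eta]_(t in On) (u t + K%:E) = \int[eta]_(t in On) u t + K%:E)%E.
  by move=> mu uK; exact: (integral_shift mO etaO mu K0 uK).
have Gj j : (\int[eta]_(t in On) G j t = (rotation_mean eta (hconj j) x)%:E + K%:E)%E.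
  rewrite shift; [|exact: mh|by move=> t tt; rewrite lee_fin hK].
  congr (_ + _)%E; rewrite /rotation_mean /haar_mean /Rintegral fineK //.
  exact: (integrable_fin_num mO (rownorm_lipschitz_integrable eta (C0 j) (HC j))).
have mG i : measurable_fun (On : set (mxborel R n)) (G i).
  by apply: emeasurable_funD => //; exact: measurable_cst.
have G0 i t : On t -> (0 <= G i t)%E.
  by move=> tt; have := hK i t tt; rewrite /G -EFinD lee_fin; lra.
have Gm t : On t -> {homo (fun i => G i t) : i j / (i <= j)%N >-> (i <= j)%E}.
  by move=> _ i j ij; rewrite /G leeD2r// lee_fin hconj_mono.
have GK : (\int[eta]_(t in On) G j t)%E @[j --> \oo] --> (\int[eta]_(t in On) g t + K%:E)%E.
  rewrite -shift//.
  have -> : (\int[eta]_(t in On) (g t + K%:E) = \int[eta]_(t in On) limn (G ^~ t))%E.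
    apply: eq_integral => t _.
    have c : G i t @[i --> \oo] --> (g t + K%:E)%E.
      by apply: cvgeD (cg t) (cvg_cst _); rewrite fin_num_adde_defl.
    by rewrite -(cvg_lim _ c).
  exact: (cvg_monotone_convergence mO mG G0 Gm).
have c : (\int[eta]_(t in On) G j t + (- K)%:E)%E @[j --> \oo] -->
    (\int[eta]_(t in On) g t + K%:E + (- K)%:E)%E.
  by apply: cvgeD GK (cvg_cst _); rewrite fin_num_adde_defl.
move: c; rewrite EFinN addeK//; apply: cvg_trans.
by apply: near_eq_cvg; apply: nearW => j /=; rewrite Gj addeK.
Qed.

Lemma rotation_mean_le_int x j : ((rotation_mean eta (hconj j) x)%:E <=
  \int[eta]_(t in On) legendre (base_fun alpha f) (invmx t *m x))%E.
Proof.
rewrite -(cvg_lim _ (@rotation_mean_cvg x))//; apply: lime_ge.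
  by apply: cvgP; exact: rotation_mean_cvg.
exists j => // i /= ji; rewrite lee_fin.
have rL k := hconj_lipschitz fC fz0 k.
apply: (rotation_mean_mono heta x (ltW (radius_gt0 z0 i))) => //.
  move=> y z; apply: le_trans (rL j y z) _.
  by rewrite ler_wpM2r ?enorm_ge0// radius_mono.
by move=> y; exact: hconj_mono.
Qed.

Lemma int_le_rotation_mean x (a : R) : (a%:E <
    \int[eta]_(t in On) legendre (base_fun alpha f) (invmx t *m x))%E ->
  exists j, a < rotation_mean eta (hconj j) x.
Proof.
move=> ax; have [j _ jP] := @rotation_mean_cvg x _ (open_nbhs_nbhs (conj (@open_ereal_gt_ereal R a%:E) ax)).
by exists j; have := jP j (leqnn j); rewrite /= lte_fin.
Qed.

End MeanConvergence.

(** * Radial convex functions *)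

Section RadialConvex.
Context {R : realType} {n : nat}.
Hypothesis n0 : (0 < n)%N.
Variable phi : 'cV[R]_n -> \bar R.
Hypotheses (phiC : Convc phi) (phir : radial phi).
Implicit Types x y z : 'cV[R]_n.

Lemma ext_convex_le x y l r s : 0 <= l <= 1 -> (phi x <= r%:E)%E -> (phi y <= s%:E)%E ->
  (phi (l *: x + (1 - l) *: y) <= (l * r + (1 - l) * s)%:E)%E.
Proof.
move=> l01 xr ys; have [_ cphi _ _ _] := phiC; apply: le_trans (cphi x y l l01) _.
have /andP[l0 l1] := l01.
by rewrite (EFinD (l * r)) (EFinM l) (EFinM (1 - l)) leeD// lee_wpmul2l// lee_fin ?subr_ge0.
Qed.

Lemma radial_eq x y : enorm x = enorm y -> phi x = phi y.
Proof. by move=> xy; have [t tt <-] := radial_orthogonal n0 xy; rewrite phir. Qed.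

(** Some point of the segment from [- x] to [x] has the norm of [y], and [phi] takes the same value
    at both ends. *)
Lemma radial_le x y r : enorm y <= enorm x -> (phi x <= r%:E)%E -> (phi y <= r%:E)%E.
Proof.
move=> yx xr; have [x0|x0] := eqVneq x 0.
  suff -> : y = x by [].
  by apply/eqP; rewrite x0 -enorm_eq0 eq_le enorm_ge0 andbT; rewrite x0 enorm0 in yx.
rewrite -enorm_gt0 in x0; pose l := (1 + enorm y / enorm x) / 2.
have yx1 : 0 <= enorm y / enorm x <= 1.
  by rewrite divr_ge0 ?enorm_ge0//= ler_pdivrMr// mul1r.
have l01 : 0 <= l <= 1 by rewrite /l; lra.
have xNr : (phi (- x) <= r%:E)%E by rewrite (@radial_eq _ x)// enormN.
have := ext_convex_le l01 xr xNr.
have -> : l * r + (1 - l) * r = r by ring.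
rewrite (@radial_eq _ y)// scalerN -scalerBl enormZ.
have -> : l - (1 - l) = enorm y / enorm x by rewrite /l; field; rewrite gt_eqF.
by rewrite ger0_norm; [rewrite divfK// gt_eqF|case/andP: yx1].
Qed.

(* A radial convex function has at [x] a supporting cone [c + s (|z| - |x|)];
   [s] is the supremum of the slopes of the chords ending at height [c] over
   the sphere through [x]. *)
Lemma radial_biconjugate x c m : (c%:E < phi x)%E ->
  (forall z v, (phi z <= v%:E)%E -> m <= v) ->
  exists y, forall z v, (phi z <= v%:E)%E -> dotv z y - v <= dotv x y - c.
Proof.
move=> cx mphi; have [cle|] := pselect (forall z v, (phi z <= v%:E)%E -> c <= v).
  by exists 0 => z v /cle; rewrite !dotv0; lra.
move=> /existsNP[z1 /existsNP[v1 /not_implyP[z1v1 /negP]]]; rewrite -ltNge => v1c.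
have phi_lt z v : (phi z <= v%:E)%E -> v <= c -> enorm z < enorm x.
  move=> zv vc; rewrite ltNge; apply/negP => /radial_le /(_ zv) xv.
  by have := lt_le_trans cx (le_trans xv (_ : (v%:E <= c%:E)%E)); rewrite lee_fin ltxx => /(_ vc).
have rho0 : 0 < enorm x.
  exact: le_lt_trans (enorm_ge0 _) (phi_lt _ _ z1v1 (ltW v1c)).
set rho := enorm x in phi_lt rho0 *.
have [e e1 xe] := unit_direction x n0; rewrite -/rho in xe.
have enormE a : 0 <= a -> enorm (a *: e) = a by move=> a0; rewrite enormZ e1 mulr1 ger0_norm.
have [_ _ lphi _ _] := phiC.
have [V xV cV] := lphi x c cx.
have /near_enormP[eta eta0 Veta] : \forall z \near x, V z by [].
(* Lower semicontinuity at [x] and radiality keep the points of height at most [c] a distance [eta]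
   inside the sphere, so the chord slopes are bounded. *)
have gap z v : (phi z <= v%:E)%E -> v <= c -> eta <= rho - enorm z.
  move=> zv vc; rewrite leNgt; apply/negP => hz.
  have /Veta/cV : enorm (enorm z *: e - x) < eta.
    rewrite xe -scalerBl enormZ e1 mulr1 distrC ger0_norm//.
    by rewrite subr_ge0 ltW// (phi_lt _ _ zv vc).
  rewrite (@radial_eq _ z) ?enormE ?enorm_ge0// => cz.
  by have := lt_le_trans cz zv; rewrite lte_fin ltNge vc.
pose S := [set (c - p.2) / (rho - enorm p.1) | p in
  [set p : 'cV[R]_n * R | (phi p.1 <= p.2%:E)%E /\ enorm p.1 < rho]].
have S1 : S ((c - v1) / (rho - enorm z1)).
  by exists (z1, v1) => //=; split => //; exact: phi_lt (ltW v1c).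
have Sub : ubound S (`|c - m| / eta).
  move=> _ [[z v] /= [zv zr] <-]; have zr0 : 0 < rho - enorm z by rewrite subr_gt0.
  have [cv|vc] := leP c v.
    apply: (@le_trans _ _ 0); last by rewrite divr_ge0 ?normr_ge0 ?ltW.
    by rewrite mulr_le0_ge0 ?subr_le0// invr_ge0 ltW.
  have hg := gap _ _ zv (ltW vc).
  rewrite ler_pdivrMr// mulrAC ler_pdivlMr//.
  apply: ler_pM => //; [by rewrite subr_ge0 ltW|exact: ltW|].
  by have := mphi _ _ zv; have := ler_norm (c - m); lra.
have hS : has_sup S by split; [exists ((c - v1) / (rho - enorm z1))|exists (`|c - m| / eta)].
pose s := sup S.
have s0 : 0 <= s.
  apply: le_trans (ub_le_sup hS.2 S1).
  by rewrite divr_ge0 ?subr_ge0 ?(ltW v1c)// ltW// (phi_lt _ _ z1v1 (ltW v1c)).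
exists (s *: e) => z v zv.
have -> : dotv x (s *: e) = s * rho.
  by rewrite xe dotvZl dotvZr -sqr_enorm e1 expr1n mulr1 mulrC.
have zs : dotv z (s *: e) <= s * enorm z.
  by rewrite dotvZr ler_wpM2l//; have := dotv_le z e; rewrite e1 mulr1.
suff : c - v <= s * (rho - enorm z) by lra.
have [zr|zr|zr] := ltgtP (enorm z) rho.
- rewrite -ler_pdivrMr ?subr_gt0//; apply: ub_le_sup; first exact: hS.2.
  by exists (z, v).
- have zr0 : 0 < enorm z - rho by rewrite subr_gt0.
  (* For [z] outside the sphere, every inner chord slope is compared with the outer one: by
     convexity the segment from [(z', v')] to [(z, v)] passes above [c] over the sphere. *)
  suff : s <= (v - c) / (enorm z - rho) by rewrite ler_pdivlMr//; lra.
  apply: ge_sup; first exact: hS.1.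
  move=> _ [[z' v'] /= [zv' zr'] <-].
  have zr0' : 0 < rho - enorm z' by rewrite subr_gt0.
  rewrite ler_pdivrMr// mulrAC ler_pdivlMr//.
  have zz : 0 < enorm z - enorm z' by lra.
  pose l := (enorm z - rho) / (enorm z - enorm z').
  have l01 : 0 <= l <= 1.
    by rewrite divr_ge0 ?(ltW zr0) ?(ltW zz)//= ler_pdivrMr// mul1r; lra.
  have pz : (phi (enorm z *: e) <= v%:E)%E.
    by rewrite (@radial_eq _ z)// enormE// enorm_ge0.
  have pz' : (phi (enorm z' *: e) <= v'%:E)%E.
    by rewrite (@radial_eq _ z')// enormE// enorm_ge0.
  have := ext_convex_le l01 pz' pz.
  rewrite !scalerA -scalerDl.
  have -> : l * enorm z' + (1 - l) * enorm z = rho by rewrite /l; field; rewrite gt_eqF.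
  rewrite -xe => /(lt_le_trans cx); rewrite lte_fin.
  have -> : l * v' + (1 - l) * v =
      ((enorm z - rho) * v' + (rho - enorm z') * v) / (enorm z - enorm z').
    by rewrite /l; field; rewrite gt_eqF.
  by rewrite ltr_pdivlMr//; lra.
- rewrite zr subrr mulr0 subr_le0.
  have xv : (phi x <= v%:E)%E by rewrite (@radial_eq x z)// zr.
  by have := lt_le_trans cx xv; rewrite lte_fin => /ltW.
Qed.

End RadialConvex.

(** * The symmetrized base function and the truncated means *)

Section PsiSym.
Context {R : realType} {n : nat}.
Hypothesis n0 : (0 < n)%N.
Variable eta : probability (mxborel R n) R.
Hypothesis heta : is_haar eta.
Variables (alpha : R) (f : 'cV[R]_n -> R) (z0 : 'cV[R]_n).
Hypotheses (fC : Calpha alpha f) (fz0 : 0 < f z0).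
Variable phi : 'cV[R]_n -> \bar R.
Hypothesis phiP : is_psi_sym eta (base_fun alpha f) phi.

Local Notation mean j := (rotation_mean eta (hconj alpha f z0 j)).

(** This is Fenchel's inequality for [phi]; as the conjugate is the increasing limit of the means,
    it holds for a large [j] with loss [e]. *)
Lemma psi_sym_conj z v y e : (phi z <= v%:E)%E -> 0 < e ->
  exists j, dotv z y - v - e < mean j y.
Proof.
move=> zv e0; have [_ _ phiL] := phiP.
apply: (int_le_rotation_mean heta fC fz0); rewrite -phiL.
apply: (@lt_le_trans _ _ (dotv z y - v)%:E); first by rewrite lte_fin; lra.
apply: (@le_trans _ _ ((dotv y z)%:E - phi z)%E); last by apply: ereal_sup_ubound; exists z.
by rewrite dotvC EFinB leeB.
Qed.

Lemma mean0_le m j : (forall x, 0 < f x -> m <= base alpha (f x)) -> mean j 0 <= - m.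
Proof.
move=> mf; apply: (rotation_mean_ub heta (ltW (radius_gt0 z0 j))).
  exact: hconj_lipschitz.
move=> y; rewrite /sphere /= enorm0 => /eqP; rewrite enorm_eq0 => /eqP ->.
apply: (tsupp_le fC fz0 (radius_ge z0 j)) => z fz _.
by rewrite dotv0; have := mf _ fz; lra.
Qed.

(** Evaluation of the conjugates at slope 0 compares the two infima. *)
Lemma psi_sym_lower m z v : (forall x, 0 < f x -> m <= base alpha (f x)) ->
  (phi z <= v%:E)%E -> m <= v.
Proof.
move=> mf zv; apply/ler_addgt0Pr => e e0.
have [j] := psi_sym_conj 0 zv e0; have := mean0_le j mf; rewrite dotv0; lra.
Qed.

(** The slope [y] of a supporting cone bounds the conjugate of [phi] at [y], and thereby all means
    at [y] at once. *)
Lemma psi_sym_biconj x c : (c%:E < phi x)%E ->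
  exists y, forall j, mean j y <= dotv x y - c.
Proof.
move=> cx; have [phiC phir phiL] := phiP.
have [m _ mf] := base_fun_lower fC.
have [y yP] := radial_biconjugate n0 phiC phir cx (fun z v => psi_sym_lower mf).
exists y => j; rewrite -lee_fin; apply: le_trans (rotation_mean_le_int heta fC fz0 y j) _.
rewrite -phiL; apply: ge_ereal_sup => _ [z _ <-].
have [phiNy _ _ _ _] := phiC; have := phiNy z; have := yP z.
case: (phi z) => [r yr _| _ _|_ //]; last by rewrite leNye.
by rewrite -EFinB lee_fin dotvC; exact: yr.
Qed.

End PsiSym.

(** * Lower limit of the base functions *)

Lemma large_index (R : realType) (e X : R) : 0 < e ->
  exists N, forall k, (N <= k)%N -> k.+1%:R^-1 < e /\ X <= k%:R.
Proof.
move=> e0; exists (maxn (Num.truncn e^-1).+1 (Num.truncn X).+1) => k.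
rewrite geq_max => /andP[k1 k2]; split.
  rewrite -[ltRHS]invrK ltf_pV2 ?posrE ?invr_gt0 ?ltr0Sn//.
  apply: lt_le_trans (Num.Theory.truncnS_gt _) _.
  by rewrite ler_nat ltnW// ltnS.
apply: le_trans (ltW (Num.Theory.truncnS_gt X)) _; by rewrite ler_nat.
Qed.

Section UpperLimit.
Context {R : realType} {n : nat}.
Hypothesis n0 : (0 < n)%N.
Variable eta : probability (mxborel R n) R.
Hypothesis heta : is_haar eta.
Variables (alpha : R) (f : 'cV[R]_n -> R) (z0 : 'cV[R]_n).
Hypotheses (fC : Calpha alpha f) (fz0 : 0 < f z0).

Local Notation base := (base alpha).
Local Notation hconj := (hconj alpha f z0).
Local Notation radius := (radius z0).
Local Notation mean j := (rotation_mean eta (hconj j)).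

(** This makes [avgs_gap], which pushes upper bounds down, usable for pushing lower bounds up. *)
Lemma ravgs_opp w (h : 'cV[R]_n -> R) x : ravgs w (fun y => - h y) x = - ravgs w h x.
Proof.
elim: w h => [//|u w IH] h; rewrite /ravgs /= -[RHS]IH.
by congr (avgs _ _ _ _); apply/funext => y; rewrite /avg; lra.
Qed.

(* Averaging along a word of bounded length that spreads a cap over the sphere
   shows that a bounded mean forces [hconj j] to be bounded somewhere on every cap. *)
Lemma hconj_cap_bound y A d : 0 < d -> (forall j, mean j y <= A) ->
  exists K, forall j p, enorm p = enorm y ->
    exists q, [/\ enorm q = enorm y, enorm (q - p) <= d & hconj j q <= K].
Proof.
move=> d0 yA.
have [m cov] := sphere_covered (enorm y) n0 ler01 d0.
pose K0 := `|hconj 0 0| + radius 0 * enorm y.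
have r0 : 0 <= radius 0 := ltW (radius_gt0 _ _).
have K00 : 0 <= K0 by rewrite addr_ge0// mulr_ge0// enorm_ge0.
have hK0 j x : sphere (enorm y) x -> - K0 <= hconj j x.
  move=> xy; have := hconj_mono fC fz0 x (leq0n j).
  have := hconj_lipschitz fC fz0 0 0 x; rewrite sub0r enormN xy.
  by have := ler_norm (- hconj 0 0); rewrite normrN /K0; lra.
have pm : 1 <= 2 ^+ m :> R by rewrite exprn_ege1// ler1n.
(* If [hconj j] exceeded [K] on a whole cap, averaging along a word of length at most [m] would
   raise it to [|A| + 1] on the sphere, contradicting the mean. *)
pose K := 2 ^+ m * (`|A| + K0 + 1); exists K => j p py.
apply: contrapT => nq.
(* The covering is applied to the distance from [p]: every point of the sphere is in the cap or is
   carried there by a letter. *)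
have [||w [ww wm wP]] := cov (fun x => enorm (x - p)) p.
- move=> a b; rewrite mul1r.
  by have := enormBD a b p; lra.
- exact: py.
have jL := hconj_lipschitz fC fz0 j.
have mw := rotation_mean_ravgs heta y (ltW (radius_gt0 z0 j)) jL ww.
have far q : enorm q = enorm y -> enorm (q - p) <= d -> K < hconj j q.
  by move=> qy qp; rewrite ltNge; apply/negP => hq; apply: nq; exists q.
have gap x : sphere (enorm y) x -> `|A| + 1 <= ravgs w (hconj j) x.
  move=> xy; rewrite -[leRHS]opprK lerNr -ravgs_opp.
  apply: le_trans (avgs_gap (M := K0) (d := K0 + K) (@stable_sphere _ _ (enorm y)) ww _ xy _) _.
  - by move=> z zy; have := hK0 j z zy; lra.
  - have := wP x xy; rewrite subrr enorm0 add0r.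
    case=> [h|[u uw h]]; [left|right; exists u => //].
      by have := far x xy h; lra.
    have uy := stable_sphere (ww _ uw) xy.
    by have := far _ uy h; lra.
  - have pw : 0 < 2 ^+ size w :> R by rewrite exprn_gt0.
    rewrite lerBlDr -lerBlDl ler_pdivlMr//.
    have : 2 ^+ size w <= 2 ^+ m :> R by rewrite ler_eXn2l// ltr1n.
    have A0 : 0 <= `|A| + K0 + 1 by have := normr_ge0 A; lra.
    move=> /(ler_wpM2r A0); rewrite -/K; lra.
have := rotation_mean_lb heta (ltW (radius_gt0 z0 j)) (lipschitz_ravgs ww jL) gap.
by rewrite mw; have := yA j; have := ler_norm A; lra.
Qed.

(** With cap radius [enorm y - r] around the point in the direction of [z], Fenchel's inequality at
    the point [q] of the cap loses only [enorm y - r] of the slope [enorm y]. *)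
Lemma base_fun_growth y A r : (forall j, mean j y <= A) -> r < enorm y ->
  exists K, forall z, 0 < f z -> r * enorm z - K <= base (f z).
Proof.
move=> yA ry; have d0 : 0 < enorm y - r by lra.
have [K KP] := hconj_cap_bound d0 yA; exists K => z fz.
have [e e1 ze] := unit_direction z n0.
pose j := Num.truncn (enorm z).
have zj : enorm z <= radius j.
  by have := Num.Theory.truncnS_gt (enorm z); have := enorm_ge0 z0; rewrite /radius /j; lra.
have [|q [qy qp hq]] := KP j (enorm y *: e).
  by rewrite enormZ e1 mulr1 ger0_norm// enorm_ge0.
have := tsupp_ub fC q fz zj; rewrite -/(hconj j q).
have := dotv_ge z (q - enorm y *: e); rewrite dotvBr.
have -> : dotv z (enorm y *: e) = enorm y * enorm z.
  by rewrite dotvZr {1}ze dotvZl -sqr_enorm e1 expr1n mulr1.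
have := ler_wpM2l (enorm_ge0 z) qp; lra.
Qed.

Variable phi : 'cV[R]_n -> \bar R.
Hypothesis phiP : is_psi_sym eta (base_fun alpha f) phi.
Variable w : nat -> seq 'cV[R]_n.
Hypothesis ww : forall k, rword (w k).
Hypothesis wP : forall k j x, (j <= k)%N -> enorm x <= k%:R ->
  `|ravgs (w k) (hconj j) x - mean j x| <= k.+1%:R^-1.

Local Notation fk k := (symmetrals alpha (w k) f).

Lemma mean_scale j y l : 0 <= l <= 1 ->
  mean j (l *: y) <= l * mean j y + (1 - l) * mean j 0.
Proof.
move=> l01; have := @rotation_mean_convex _ _ eta heta _ (hconj j) y 0 l
  (ltW (radius_gt0 z0 j)) (hconj_lipschitz fC fz0 j).
rewrite scaler0 addr0; apply=> a b.
exact: (tsupp_convex fC fz0 _ _ (radius_ge z0 j) l01).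
Qed.

Lemma symmetrals_liminf x b : (b%:E < phi x)%E ->
  exists2 d, 0 < d & exists N, forall k, (N <= k)%N -> forall x' : 'cV[R]_n, enorm (x' - x) < d ->
    0 < fk k x' -> b < base (fk k x').
Proof.
move=> bx.
have [c bc cx] : exists2 c, b < c & (c%:E < phi x)%E.
  move: bx; case: (phi x) => [r| |//]; rewrite ?lte_fin => br; last first.
    by exists (b + 1); [lra|exact: ltry].
  by exists ((b + r) / 2); rewrite ?lte_fin; lra.
have [m _ mf] := base_fun_lower fC.
have [y yP] := psi_sym_biconj n0 heta fC fz0 phiP cx.
(* At slope 0 there is nothing to shrink: the bound says that [base (f z) >= c] wherever [f z > 0],
   and averages of a constant are constant. *)
have [y00|y0] := eqVneq y 0.
  exists 1 => //; exists 0%N => k _ x' _ fx'.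
  have fle z y' : 0 < f z -> enorm y' = 0 -> dotv z y' - base (f z) <= - c.
    move=> fz /eqP; rewrite enorm_eq0 => /eqP ->; rewrite dotv0 sub0r.
    have [j] := hconj_ub z0 fC 0 fz; rewrite dotv0 => hj.
    have := yP j; rewrite y00 dotv0.
    have : hconj j 0 <= mean j 0.
      apply: (rotation_mean_lb heta (ltW (radius_gt0 z0 j)) (hconj_lipschitz fC fz0 j)).
      by move=> y''; rewrite /sphere /= enorm0 => /eqP; rewrite enorm_eq0 => /eqP ->.
    lra.
  have := symmetrals_fenchel (h := fun=> - c) (@ww k) fC fle fx' (enorm0 (n := n)).
  rewrite dotv0 sub0r.
  have /andP[_ h0] : - c <= ravgs (w k) (fun=> - c) 0 <= - c.
    by apply: (avgs_bounds (@stable_sphere R n 0) (@ww k)) => [y' _|]; rewrite ?lexx//= /sphere /= enorm0.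
  lra.
pose M := `|c - m| + 1; have M0 : 0 < M by rewrite ltr_wpDl.
(* Shrinking [y] by the factor [1 - l] changes the bound by at most [l * M], half of the available
   room [c - b]. *)
pose l := Num.min (1 / 2) ((c - b) / (2 * M)).
have l0 : 0 < l by rewrite lt_min divr_gt0//= divr_gt0 ?subr_gt0// mulr_gt0.
have l1 : l <= 1 / 2 by rewrite ge_min lexx.
have lM : l * M <= (c - b) / 2.
  have : l <= (c - b) / (2 * M) by rewrite ge_min lexx orbT.
  rewrite -(ler_pM2r M0) => /le_trans; apply.
  by rewrite le_eqVlt; apply/orP; left; apply/eqP; field; rewrite gt_eqF.
set t := 1 - l; have t01 : 0 <= t <= 1 by rewrite /t; lra.
pose c' := (c + b) / 2.
have meanty j : mean j (t *: y) <= dotv x (t *: y) - c'.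
  have := mean_scale j y t01; have := mean0_le heta fC fz0 j mf => h0.
  have := ler_wpM2l (ltW l0) h0; have t0 : 0 <= t by lra.
  have := ler_wpM2l t0 (yP j); rewrite dotvZr.
  have : l * (c - m) <= l * M by rewrite ler_pM2l// /M; have := ler_norm (c - m); lra.
  by rewrite /c' /t; lra.
have yn0 : 0 < enorm y by rewrite enorm_gt0.
have tyE : enorm (t *: y) = t * enorm y by rewrite enormZ ger0_norm//; lra.
(* This rate lies strictly between the norms of [t *: y] and [y]. *)
pose r := (1 - l / 2) * enorm y.
have ry : r < enorm y by rewrite /r gtr_pMl//; lra.
have tyr : enorm (t *: y) < r by rewrite tyE /r ltr_pM2r// /t; lra.
have [K KP] := base_fun_growth yP ry.
have rty : 0 < r - enorm (t *: y) by lra.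
pose H0 := `|hconj 0 0| + radius 0 * enorm (t *: y).
have hH0 j y'' : enorm y'' = enorm (t *: y) -> - H0 <= hconj j y''.
  move=> yy; have := hconj_mono fC fz0 y'' (leq0n j).
  have := hconj_lipschitz fC fz0 0 0 y''; rewrite sub0r enormN yy.
  by have := ler_norm (- hconj 0 0); rewrite normrN /H0; lra.
(* Beyond the ball of radius [radius J], growth at rate [r] pushes [dotv z y'' - base (f z)] below
   the lower bound [- H0] of the truncated conjugates. *)
pose J := Num.truncn ((K + H0) / (r - enorm (t *: y))).
have fle z y'' : 0 < f z -> enorm y'' = enorm (t *: y) ->
    dotv z y'' - base (f z) <= hconj J y''.
  move=> fz yy; have [zJ|Jz] := leP (enorm z) (radius J); first exact: tsupp_ub.
  apply: le_trans (hH0 J y'' yy).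
  have zbig : (K + H0) / (r - enorm (t *: y)) <= enorm z.
    apply: ltW; apply: lt_le_trans (Num.Theory.truncnS_gt _) _.
    by apply: le_trans (ltW Jz); rewrite /radius lerDr enorm_ge0.
  rewrite ler_pdivrMr// in zbig.
  have := KP z fz; have := dotv_le z y''; rewrite yy; lra.
have D0 : 0 < (c' - b) / 2 by rewrite /c'; lra.
pose Y := enorm (t *: y) + 1; have Y0 : 0 < Y by rewrite ltr_wpDl ?enorm_ge0.
have [N1 N1P] := large_index (enorm (t *: y)) D0.
exists ((c' - b) / 2 / Y); first by rewrite divr_gt0.
exists (maxn N1 J) => k; rewrite geq_max => /andP[kN kJ] x' xx' fx'.
have [k1 k2] := N1P _ kN.
have h1 := symmetrals_fenchel (@ww k) fC fle fx' erefl.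
have := wP kJ k2; rewrite ler_norml => /andP[_ h2].
have h3 := meanty J.
have := dotv_ge (x' - x) (t *: y); rewrite dotvBl => h4.
have h5 : enorm (x' - x) * enorm (t *: y) <= (c' - b) / 2.
  have xx2 : enorm (x' - x) * Y <= (c' - b) / 2 by rewrite -ler_pdivlMr// ltW.
  by apply: le_trans xx2; rewrite ler_wpM2l ?enorm_ge0// /Y; lra.
have h6 := le_lt_trans h2 k1; rewrite -lerN2 in h5; have h7 := le_trans h5 h4.
by move: h1 h3 h6 h7; clear; lra.
Qed.

End UpperLimit.

(** * Recovery points *)

Section ApproximateSubgradients.
Context {R : realType} {n : nat}.
Variables (C g : 'cV[R]_n -> R) (L k K : R) (e : 'cV[R]_n).
Hypotheses (L0 : 0 <= L) (CL : lipschitz L C)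
  (Cr : forall x y, enorm x = enorm y -> C x = C y)
  (gC : forall y, enorm y <= K -> `|g y - C y| <= k) (e1 : enorm e = 1).

(** One [k] comes from the near contact at [x], the other two from replacing [g] by [C] at [x] and
    at [y]. *)
Lemma approx_subgradient z v x y :
  (forall y, dotv z y - v <= g y) -> g x - k < dotv z x - v ->
  enorm x <= K -> enorm y <= K -> dotv z y - dotv z x <= C y - C x + 3 * k.
Proof.
move=> zg zx xK yK; have := gC xK; have := gC yK; rewrite !ler_norml.
by have := zg y; lra.
Qed.

Lemma enorm_line s : enorm (s *: e) = `|s|.
Proof. by rewrite enormZ e1 mulr1. Qed.

Lemma dotv_line z s : dotv z (s *: e) = s * dotv z e.
Proof. exact: dotvZr. Qed.

Lemma radial_increment s x : s != 0 -> `|s| <= enorm x -> C x - C (s *: e) <= L * (enorm x - `|s|).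
Proof.
move=> s0 sx; have sp : 0 < `|s| by rewrite normr_gt0.
have x0 : 0 < enorm x by exact: lt_le_trans sx.
pose x' := (enorm x / `|s|) *: (s *: e).
have -> : C x = C x'.
  by apply: Cr; rewrite enormZ enorm_line ger0_norm ?divr_ge0 ?ltW// divfK// gt_eqF.
apply: le_trans (CL _ _) _; rewrite ler_wpM2l//.
have -> : x' - s *: e = (enorm x / `|s| - 1) *: (s *: e) by rewrite /x' scalerBl scale1r.
rewrite enormZ enorm_line ger0_norm; last by rewrite subr_ge0 ler_pdivlMr// mul1r.
by rewrite mulrBl mul1r divfK// gt_eqF.
Qed.

Lemma radial_minimizer0 : (forall y, C 0 <= C y) ->
  forall s, C (0 *: e) - 0 * 0 <= C (s *: e) - 0 * s.
Proof. by move=> C0 s; rewrite scale0r !mul0r !subr0. Qed.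

(** Convexity from the origin extends the growth rate [c] from [s0] to all larger distances. Since
    [a <= c], points beyond [s0] do no better than 0, and a minimum over [[- s0, s0]] is global. *)
Lemma radial_minimizer a c s0 : 0 <= a -> a <= c -> 0 < s0 ->
  (forall y l, 0 <= l <= 1 -> C (l *: y) <= l * C y + (1 - l) * C 0) ->
  c * s0 + C 0 <= C (s0 *: e) ->
  exists2 s, `|s| <= s0 &
    forall s', C (s *: e) - a * s <= C (s' *: e) - a * s'.
Proof.
move=> a0 ac s00 Cc Cs0.
have far s : s0 <= `|s| -> c * `|s| + C 0 <= C (s *: e).
  move=> ss; have sp : 0 < `|s| by exact: lt_le_trans ss.
  have l01 : 0 <= s0 / `|s| <= 1.
    by rewrite divr_ge0 ?(ltW s00) ?(ltW sp)//= ler_pdivrMr// mul1r.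
  have h := Cc (`|s| *: e) _ l01.
  have eq1 : C (`|s| *: e) = C (s *: e) by apply: Cr; rewrite !enorm_line normr_id.
  rewrite scalerA divfK ?gt_eqF// eq1 in h.
  move: h Cs0; move: (C (s0 *: e)) (C (s *: e)) (C 0) => M1 M M0 h h1.
  have h2 : c * s0 <= s0 / `|s| * (M - M0) by rewrite mulrBr; lra.
  have h3 : c <= (M - M0) / `|s|.
    rewrite -(ler_pM2r s00); apply: le_trans h2 _.
    by rewrite le_eqVlt; apply/orP; left; apply/eqP; field; rewrite gt_eqF.
  by rewrite ler_pdivlMr// in h3; lra.
pose D s := C (s *: e) - a * s.
have Dc : {within `[- s0, s0], continuous D}.
  apply: continuous_subspaceT => s; apply/cvgrPdist_le => d d0.
  pose B := L + a + 1; have B0 : 0 < B by rewrite ltr_wpDl// addr_ge0.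
  have dB : 0 < d / B by rewrite divr_gt0.
  near=> t; have ts : `|s - t| <= d / B.
    by near: t; exact: (@cvgr_dist_le _ _ _ (nbhs s) _ id s cvg_id).
  rewrite ler_pdivlMr// in ts.
  have h1 := CL (s *: e) (t *: e); have h2 := CL (t *: e) (s *: e).
  rewrite -!scalerBl !enorm_line (distrC t s) in h1 h2.
  have h3 : `|a * s - a * t| <= a * `|s - t| by rewrite -mulrBr normrM ger0_norm.
  rewrite /D; move: h1 h2 h3 ts (normr_ge0 (s - t)); rewrite /B !ler_norml.
  move: (C (s *: e)) (C (t *: e)) `|s - t| (a * s) (a * t) => M1 M2 r q1 q2.
  rewrite mulrDr mulr1 mulrDr (mulrC r L) (mulrC r a).
  by move: (L * r) (a * r) => r1 r2; lra.
have s0s0 : - s0 <= s0 by lra.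
have [s /andP[s1 s2] smin] := EVT_min s0s0 Dc.
have ss0 : `|s| <= s0 by move: s1 s2; rewrite !bnd_simp ler_norml => -> ->.
exists s => // s'.
have [s's0|/ltW s's0] := leP `|s'| s0.
  by apply: smin; rewrite in_itv/= -ler_norml.
have D0 : D s <= D 0 by apply: smin; rewrite in_itv/= oppr_le0 (ltW s00).
apply: le_trans D0 _; rewrite /D scale0r mulr0 subr0.
have h1 := far _ s's0.
have h2 : a * s' <= a * `|s'| by rewrite ler_wpM2l// ler_norm.
have h3 : a * `|s'| <= c * `|s'| by rewrite ler_wpM2r.
by rewrite lerBrDr; apply: le_trans h1; rewrite addrC lerD2r; exact: le_trans h3.
Unshelve. all: by end_near. Qed.

(* A radial function grows only to second order in directions orthogonal to
   its argument, so subgradients at [s *: e] are almost parallel to [e]. *)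
Lemma subgradient_transversal z v s t :
  (forall y, dotv z y - v <= g y) -> g (s *: e) - k < dotv z (s *: e) - v ->
  s != 0 -> 0 < t -> `|s| + t <= K -> 0 <= k ->
  enorm (z - dotv z e *: e) <= L * t / (2 * `|s|) + 3 * k / t.
Proof.
move=> zg zs s0 t0 stK k0; set p := z - _.
have sp : 0 < `|s| by rewrite normr_gt0.
have rhs0 : 0 <= L * t / (2 * `|s|) + 3 * k / t.
  by rewrite addr_ge0// divr_ge0 ?mulr_ge0// ltW.
have [->|p0] := eqVneq p 0; first by rewrite enorm0.
rewrite -enorm_gt0 in p0; pose u := (enorm p)^-1 *: p.
have pe : dotv p e = 0.
  by rewrite /p dotvBl dotvZl -sqr_enorm e1 expr1n mulr1 subrr.
have u1 : enorm u = 1 by rewrite enormZ gtr0_norm ?invr_gt0// mulVf// gt_eqF.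
have ue : dotv u e = 0 by rewrite dotvZl pe mulr0.
have zu : dotv z u = enorm p.
  have -> : z = p + dotv z e *: e by rewrite /p subrK.
  rewrite dotvDl dotvZl (dotvC e) ue mulr0 addr0 dotvZr -sqr_enorm.
  by rewrite expr2 mulrA mulVf ?mul1r// gt_eqF.
(* The subgradient is tested at distance [t] along its transversal direction [u], where the norm
   exceeds [|s|] by at most [t ^+ 2 / (2 * |s|)]. *)
clearbody u; pose x := s *: e + t *: u.
have xx : enorm x ^+ 2 = s ^+ 2 + t ^+ 2.
  rewrite sqr_enorm dotvDl !dotvDr !(dotvZl, dotvZr) (dotvC e u) ue -!sqr_enorm e1 u1.
  ring.
have sx : `|s| <= enorm x.
  by apply: norm_le_sqr; rewrite ?enorm_ge0// xx lerDl sqr_ge0.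
have xs : enorm x <= `|s| + t ^+ 2 / (2 * `|s|).
  have b0 : 0 <= `|s| + t ^+ 2 / (2 * `|s|).
    by rewrite addr_ge0// divr_ge0 ?sqr_ge0// mulr_ge0.
  have := @norm_le_sqr _ (enorm x) _ b0; rewrite (ger0_norm (enorm_ge0 x)); apply.
  rewrite xx sqrrD -[s ^+ 2](real_normK (num_real s)).
  have -> : `|s| * (t ^+ 2 / (2 * `|s|)) *+ 2 = t ^+ 2 by field; rewrite gt_eqF.
  by rewrite lerDl sqr_ge0.
have xK : enorm x <= K.
  apply: le_trans stK; apply: le_trans (enormD _ _) _.
  by rewrite enorm_line enormZ u1 mulr1 (gtr0_norm t0).
have sK : enorm (s *: e) <= K by rewrite enorm_line; lra.
have := approx_subgradient zg zs sK xK.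
rewrite /x dotvDr [dotv z (t *: u)]dotvZr zu -/x addrAC subrr add0r => h1.
have := radial_increment s0 sx; have := ler_wpM2l L0 xs => h2 h3.
have {h1 h2 h3} h : t * enorm p <= L * (t ^+ 2 / (2 * `|s|)) + 3 * k.
  by move: h1 h2 h3; rewrite mulrDr mulrBr; lra.
rewrite -(ler_pM2l t0); apply: le_trans h _.
rewrite le_eqVlt; apply/orP; left; apply/eqP.
by field; rewrite !gt_eqF.
Qed.

Lemma convex_between (a1 a2 a mu : R) : 0 <= mu -> a1 <= a + mu -> a - mu <= a2 ->
  exists2 l, 0 <= l <= 1 & `|l * a1 + (1 - l) * a2 - a| <= mu.
Proof.
move=> mu0 h1 h2; have [h|h] := leP (a - mu) a1.
  exists 1; first by rewrite ler01 lexx.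
  by rewrite mul1r subrr mul0r addr0 ler_norml; lra.
have [h'|h'] := leP a2 (a + mu).
  exists 0; first by rewrite ler01 lexx.
  by rewrite mul0r subr0 mul1r add0r ler_norml; lra.
have aa : 0 < a2 - a1 by lra.
exists ((a2 - a) / (a2 - a1)).
  by rewrite divr_ge0 ?(ltW aa)//=; [rewrite ler_pdivrMr//; lra|lra].
have -> : (a2 - a) / (a2 - a1) * a1 + (1 - (a2 - a) / (a2 - a1)) * a2 - a = 0.
  by field; rewrite gt_eqF.
by rewrite normr0.
Qed.

Variable E : 'cV[R]_n -> R -> Prop.
Hypotheses (EL : forall z v, E z v -> enorm z <= L)
  (Eg : forall y z v, E z v -> dotv z y - v <= g y)
  (gE : forall y e, 0 < e -> exists z v, E z v /\ g y - e < dotv z y - v).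

(** Minimality at [s] makes the e-components at [s - d] and [s + d] bracket [a] up to [3 * k / d].
    The parameter [sg] keeps both points away from the origin, where the transversal estimate
    degenerates. For fixed [d], [t], [sg], the terms in [k] vanish with [k]. *)
Lemma epigraph_point_near_ray (a s d t sg : R) :
  (forall s', C (s *: e) - a * s <= C (s' *: e) - a * s') ->
  0 < k -> 0 < d -> 0 < t -> 0 < sg -> sg <= `|s - d| -> sg <= `|s + d| ->
  `|s| + d + t <= K ->
  exists z1 v1 z2 v2 l, [/\ E z1 v1, E z2 v2, 0 <= l <= 1,
    enorm (l *: z1 + (1 - l) *: z2 - a *: e) <=
      3 * k / d + (L * t / (2 * sg) + 3 * k / t) &
    l * v1 + (1 - l) * v2 <=
      a * s - C (s *: e) + `|s| * (3 * k / d) + 2 * L * d + k * 2].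
Proof.
move=> smin k0 d0 t0 sg0 sg1 sg2 sK.
have dd : `|d| = d by rewrite ger0_norm// ltW.
have s1K : `|s - d| + t <= K by have := ler_normB s d; lra.
have s2K : `|s + d| + t <= K by have := ler_normD s d; lra.
have s1K' : enorm ((s - d) *: e) <= K by rewrite enorm_line; lra.
have s2K' : enorm ((s + d) *: e) <= K by rewrite enorm_line; lra.
have sK' : enorm (s *: e) <= K by rewrite enorm_line; lra.
have [z1 [v1 [E1 h1]]] := gE ((s - d) *: e) k0.
have [z2 [v2 [E2 h2]]] := gE ((s + d) *: e) k0.
have s10 : s - d != 0 by rewrite -normr_gt0; exact: lt_le_trans sg1.
have s20 : s + d != 0 by rewrite -normr_gt0; exact: lt_le_trans sg2.
set a1 := dotv z1 e; set a2 := dotv z2 e; set mu := 3 * k / d.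
have mu0 : 0 <= mu by rewrite divr_ge0 ?ltW// mulr_gt0.
have mud : mu * d = 3 * k by rewrite /mu divfK// gt_eqF.
have b1 : a1 <= a + mu.
  have := approx_subgradient (fun y => Eg y E1) h1 s1K' sK'.
  rewrite !dotv_line -/a1 => h; have := smin (s - d) => h'.
  rewrite -(ler_pM2r d0) mulrDl mud; move: h h'; lra.
have b2 : a - mu <= a2.
  have := approx_subgradient (fun y => Eg y E2) h2 s2K' sK'.
  rewrite !dotv_line -/a2 => h; have := smin (s + d) => h'.
  rewrite -(ler_pM2r d0) mulrBl mud; move: h h'; lra.
have [l l01 la] := convex_between mu0 b1 b2.
exists z1, v1, z2, v2, l; split => //.
  have tr1 := subgradient_transversal (fun y => Eg y E1) h1 s10 t0 s1K (ltW k0).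
  have tr2 := subgradient_transversal (fun y => Eg y E2) h2 s20 t0 s2K (ltW k0).
  have Lt0 : 0 <= L * t by rewrite mulr_ge0// ltW.
  have inv_le r : sg <= r -> L * t / (2 * r) <= L * t / (2 * sg).
    move=> sgr; rewrite ler_wpM2l// lef_pV2 ?posrE ?mulr_gt0 ?ler_pM2l//.
    exact: lt_le_trans sgr.
  have := inv_le _ sg1; have := inv_le _ sg2.
  set B1 := L * t / (2 * `|s - d|) in tr1 *.
  set B2 := L * t / (2 * `|s + d|) in tr2 *.
  set B := L * t / (2 * sg); set T := 3 * k / t in tr1 tr2 *.
  move=> B2B B1B.
  have -> : l *: z1 + (1 - l) *: z2 - a *: e =
      (l * a1 + (1 - l) * a2 - a) *: e +
      (l *: (z1 - a1 *: e) + (1 - l) *: (z2 - a2 *: e)).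
    by apply/matrixP => i j; rewrite !mxE; ring.
  have /andP[l0 l1] := l01; have l1' : 0 <= 1 - l by lra.
  apply: le_trans (enormD _ _) _; rewrite enorm_line; apply: lerD => //.
  apply: le_trans (enormD _ _) _; rewrite !enormZ !ger0_norm//.
  have t1 : l * enorm (z1 - a1 *: e) <= l * (B + T).
    by rewrite ler_wpM2l//; apply: le_trans tr1 _; rewrite lerD2r.
  have t2 : (1 - l) * enorm (z2 - a2 *: e) <= (1 - l) * (B + T).
    by rewrite ler_wpM2l//; apply: le_trans tr2 _; rewrite lerD2r.
  by move: t1 t2; lra.
have aL z v : E z v -> `|dotv z e| <= L.
  move=> Ez; have := dotv_le z e; have := dotv_ge z e; have := EL Ez.
  by rewrite e1 mulr1 ler_norml; lra.
have val z v r : E z v -> g (r *: e) - k < dotv z (r *: e) - v -> `|r - s| = d ->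
    enorm (r *: e) <= K -> v <= s * dotv z e - C (s *: e) + 2 * L * d + k * 2.
  move=> Ez hz rs rK; have := gC rK; rewrite ler_norml => /andP[g1 _].
  have := CL (s *: e) (r *: e); rewrite -scalerBl enorm_line distrC rs => c1.
  rewrite dotv_line in hz.
  have : (r - s) * dotv z e <= d * L.
    apply: le_trans (ler_norm _) _; rewrite normrM rs ler_wpM2l ?(ltW d0)//.
    exact: aL Ez.
  move: g1 c1 hz; lra.
have rd1 : `|s - d - s| = d by rewrite addrAC subrr sub0r normrN.
have rd2 : `|s + d - s| = d by rewrite addrAC subrr add0r.
have w1 := val _ _ _ E1 h1 rd1 s1K'; have w2 := val _ _ _ E2 h2 rd2 s2K'.
have /andP[l0 l1] := l01; have l1' : 0 <= 1 - l by lra.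
have := ler_wpM2l l0 w1; have := ler_wpM2l l1' w2; rewrite -/a1 -/a2.
have : s * (l * a1 + (1 - l) * a2 - a) <= `|s| * mu.
  by apply: le_trans (ler_norm _) _; rewrite normrM ler_wpM2l.
lra.
Qed.

End ApproximateSubgradients.

Section LowerLimit.
Context {R : realType} {n : nat}.
Hypothesis n0 : (0 < n)%N.
Variable eta : probability (mxborel R n) R.
Hypothesis heta : is_haar eta.
Variables (alpha : R) (f : 'cV[R]_n -> R) (z0 : 'cV[R]_n).
Hypotheses (fC : Calpha alpha f) (fz0 : 0 < f z0).

Local Notation base := (base alpha).
Local Notation hconj := (hconj alpha f z0).
Local Notation radius := (radius z0).
Local Notation mean j := (rotation_mean eta (hconj j)).

Lemma mean_lipschitz j : lipschitz (radius j) (mean j).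
Proof.
exact: (rotation_mean_lipschitz heta (ltW (radius_gt0 z0 j)) (hconj_lipschitz fC fz0 j)).
Qed.

Lemma mean_radial j x y : enorm x = enorm y -> mean j x = mean j y.
Proof.
exact: (rotation_mean_radial heta n0 (ltW (radius_gt0 z0 j)) (hconj_lipschitz fC fz0 j)).
Qed.

Lemma mean_mono i j y : (i <= j)%N -> mean i y <= mean j y.
Proof.
move=> ij; have rL k := hconj_lipschitz fC fz0 k.
apply: (rotation_mean_mono heta y (ltW (radius_gt0 z0 j))) => //.
  move=> x z; apply: le_trans (rL i x z) _.
  by rewrite ler_wpM2r ?enorm_ge0// radius_mono.
by move=> x; exact: hconj_mono.
Qed.

(** The origin is the midpoint of [y] and [- y], where the mean has equal values. *)
Lemma mean_min0 j y : mean j 0 <= mean j y.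
Proof.
have l01 : 0 <= (1 / 2 : R) <= 1 by lra.
have := @rotation_mean_convex _ _ eta heta _ (hconj j) y (- y) (1 / 2)
  (ltW (radius_gt0 z0 j)) (hconj_lipschitz fC fz0 j)
  (fun a b => tsupp_convex fC fz0 a b (radius_ge z0 j) l01).
have -> : 1 / 2 *: y + (1 - 1 / 2) *: - y = 0.
  by apply/matrixP => a b; rewrite !mxE; field.
rewrite (@mean_radial j (- y) y) ?enormN//.
by move: (mean j y) (mean j 0) => M M0; lra.
Qed.

Variable phi : 'cV[R]_n -> \bar R.
Hypothesis phiP : is_psi_sym eta (base_fun alpha f) phi.

(* Dini's argument: on a ball, the increasing functions [mean j] exceed
   [dotv x' y - v - e] simultaneously for one large [j]. *)
Lemma mean_above_ball x' v S e : (phi x' <= v%:E)%E -> 0 < e ->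
  exists J, forall j y, (J <= j)%N -> enorm y <= S -> dotv x' y - v - e <= mean j y.
Proof.
move=> xv e0.
pose Q (y : 'cV[R]_n) (d : R) := forall j, d^-1 <= j%:R -> dotv x' y - v - e <= mean j y.
have [||d d0 dQ] := @compact_uniform _ _ S Q.
- move=> y d d' d'0 dd' Qy j dj; apply: Qy; apply: le_trans dj.
  by rewrite lef_pV2// posrE//; exact: lt_le_trans dd'.
- move=> y; have e2 : 0 < e / 2 by rewrite divr_gt0.
  have [j hj] := psi_sym_conj heta fC fz0 phiP y xv e2.
  pose B := radius j + enorm x' + 1.
  have B0 : 0 < B by rewrite addr_gt0// ltr_pwDl ?radius_gt0// enorm_ge0.
  exists (Num.min (e / 2 / B) j.+1%:R^-1); first by rewrite lt_min invr_gt0 ltr0Sn !divr_gt0.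
  move=> y'; rewrite lt_min => /andP[yy _] i.
  move=> di; have ji : (j <= i)%N.
    apply: ltnW; rewrite -(ltr_nat R); apply: lt_le_trans di.
    apply: (@lt_le_trans _ _ j.+1%:R); first by rewrite ltr_nat.
    rewrite -[leLHS]invrK lef_pV2 ?posrE ?lt_min ?invr_gt0 ?ltr0Sn ?divr_gt0//.
    by rewrite ge_min lexx orbT.
  have := mean_mono y' ji; have := mean_lipschitz j y y'.
  have := dotv_le x' (y' - y); rewrite dotvBr (enormB y) => h1 h2 h3.
  have h4 : enorm (y' - y) * B <= e / 2 by rewrite -ler_pdivlMr// ltW.
  have h5 : 0 <= enorm (y' - y) := enorm_ge0 _.
  have {}h4 : radius j * enorm (y' - y) + enorm x' * enorm (y' - y) + enorm (y' - y) <= e / 2.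
    by move: h4; rewrite mulrC /B mulrDl mul1r mulrDl.
  move: hj h1 h2 h3 h4 h5; move: (mean j y) (mean j y') (mean i y') => M1 M2 M3.
  by move: (dotv x' y) (dotv x' y') => q1 q2; lra.
exists (Num.truncn d^-1).+1 => j y Jj yS; apply: dQ => //.
apply: le_trans (ltW (Num.Theory.truncnS_gt _)) _; by rewrite ler_nat.
Qed.

(** Finiteness of [phi] at [b *: e1] makes the means grow along the line faster than slope [a], so a
    minimizer exists; for [a = 0] the origin is one. *)
Lemma mean_minimizer e1 a b v e : enorm e1 = 1 -> 0 <= a -> (a = 0 \/ a < b) ->
  (phi (b *: e1) <= v%:E)%E -> (phi (a *: e1) <= v%:E)%E -> 0 < e ->
  exists j s, (forall s', mean j (s *: e1) - a * s <= mean j (s' *: e1) - a * s') /\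
    a * s - mean j (s *: e1) <= v + e.
Proof.
move=> e11 a0 ab bv av e0.
have line s : enorm (s *: e1) = `|s| by rewrite enormZ e11 mulr1.
have dline s t : dotv (s *: e1) (t *: e1) = s * t.
  by rewrite dotvZl dotvZr -sqr_enorm e11 expr1n mulr1.
case: ab => [a00|ab].
  have [J JP] := mean_above_ball 0 av e0.
  exists J, 0; rewrite a00; split; first exact: radial_minimizer0 (@mean_min0 J).
  have := JP J 0 (leqnn J); rewrite enorm0 lexx dotv0 => /(_ isT).
  by rewrite scale0r mul0r; move: (mean J 0) => M; lra.
have [m _ mf] := base_fun_lower fC.
pose c := (a + b) / 2; have bc : 0 < b - c by rewrite /c; lra.
have ac : a <= c by rewrite /c; lra.
(* At [s0] the growth at rate [b], less the loss [v + 1], still exceeds growth at rate [c] from the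
   value at 0, which is at most [- m]. *)
pose s0 := (`|v - m| + 2) / (b - c).
have s00 : 0 < s0 by rewrite divr_gt0// ltr_wpDl.
have s0E : s0 * (b - c) = `|v - m| + 2 by rewrite /s0 divfK// gt_eqF.
have [j1 hj1] := psi_sym_conj heta fC fz0 phiP (s0 *: e1) bv ltr01.
rewrite dline in hj1.
(* As [s0] is fixed before [j], the uniform bound on its ball covers the minimizer of whichever mean
   is chosen. *)
have [J JP] := mean_above_ball s0 av e0.
have [j jj1 jJ] : exists2 j, (j1 <= j)%N & (J <= j)%N.
  by exists (maxn j1 J); [exact: leq_maxl|exact: leq_maxr].
have hs0 : c * s0 + mean j 0 <= mean j (s0 *: e1).
  apply: le_trans (mean_mono _ jj1); apply: le_trans (ltW hj1).
  have := mean0_le heta fC fz0 j mf; move: (mean j 0) => M0 hM0.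
  by have := ler_norm (v - m); move: s0E; rewrite mulrBr; lra.
have [s ss0 smin] := radial_minimizer (ltW (radius_gt0 z0 j)) (@mean_lipschitz j)
  (@mean_radial j) e11 a0 ac s00 (fun y l l01 => mean_scale heta fC fz0 j y l01) hs0.
exists j, s; split => //.
have := JP j (s *: e1) jJ; rewrite line dline => /(_ ss0).
by rewrite -addrA -opprD lerBlDr -lerBlDl.
Qed.

Variable w : nat -> seq 'cV[R]_n.
Hypothesis ww : forall k, rword (w k).
Hypothesis wP : forall k j x, (j <= k)%N -> enorm x <= k%:R ->
  `|ravgs (w k) (hconj j) x - mean j x| <= k.+1%:R^-1.

Local Notation fk k := (symmetrals alpha (w k) f).

Lemma symmetrals_recovery_ray e1 a b v e : enorm e1 = 1 -> 0 <= a -> (a = 0 \/ a < b) ->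
  (phi (b *: e1) <= v%:E)%E -> (phi (a *: e1) <= v%:E)%E -> 0 < e ->
  exists N, forall k, (N <= k)%N -> exists z,
    [/\ 0 < fk k z, enorm (z - a *: e1) < e & base (fk k z) < v + e].
Proof.
move=> e11 a0 ab bv av e0; have e4 : 0 < e / 4 by rewrite divr_gt0.
have e8 : 0 < e / 8 by rewrite divr_gt0.
have [j [s [smin sval]]] := mean_minimizer e11 a0 ab bv av e4.
pose L := radius j; have L0 : 0 < L := radius_gt0 z0 j.
pose d0 := e / 16 / L; have d00 : 0 < d0 by rewrite !divr_gt0.
(* The transversal estimate needs [s - d] and [s + d] nonzero; [d0] fails only if [|s| = d0], and
   then [d0 / 2] works. *)
have [d [dp Ld sd1 sd2]] : exists d, [/\ 0 < d, L * d <= e / 16, s - d != 0 & s + d != 0].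
  have Ld0 : L * d0 = e / 16 by rewrite /d0 mulrCA mulfV ?mulr1// gt_eqF.
  have [sd|sd] := eqVneq `|s| d0.
    have s0p : 0 < d0 / 2 by rewrite divr_gt0.
    exists (d0 / 2); split; [by rewrite divr_gt0|lra| |].
    - apply/eqP => h; have s2 : s = d0 / 2 by lra.
      by have := ger0_norm (ltW s0p); rewrite -s2 sd; lra.
    - apply/eqP => h; have s2 : s = - (d0 / 2) by lra.
      by have := ger0_norm (ltW s0p); rewrite -normrN -s2 sd; lra.
  exists d0; split; [by []|lra| |].
  - apply: contra_neq sd => h; have -> : s = d0 by lra.
    by rewrite ger0_norm// ltW.
  - apply: contra_neq sd => h; have -> : s = - d0 by lra.
    by rewrite normrN ger0_norm// ltW.
pose sg := Num.min `|s - d| `|s + d|.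
have sg0 : 0 < sg by rewrite lt_min !normr_gt0 sd1.
have sg1 : sg <= `|s - d| by rewrite ge_min lexx.
have sg2 : sg <= `|s + d| by rewrite ge_min lexx orbT.
pose t := e * sg / (4 * L); have t0 : 0 < t by rewrite divr_gt0 ?mulr_gt0.
have tE : L * t / (2 * sg) = e / 8 by rewrite /t; field; rewrite !gt_eqF.
(* [D] collects the coefficients of the averaging error [kap] in the bounds of
   [epigraph_point_near_ray]; it does not depend on [k]. *)
pose D := 3 / t + 3 / d + `|s| * (3 / d) + 2.
have it : 0 < 3 / t by rewrite divr_gt0.
have id : 0 < 3 / d by rewrite divr_gt0.
have sid : 0 <= `|s| * (3 / d) by rewrite mulr_ge0// ltW.
have D0 : 0 < D by rewrite /D; lra.
have [N NP] := large_index (`|s| + d + t) (divr_gt0 e8 D0).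
exists (maxn N j) => k; rewrite geq_max => /andP[Nk jk].
have [kk kX] := NP k Nk; set kap := k.+1%:R^-1 in kk *.
have kap0 : 0 < kap by rewrite invr_gt0 ltr0Sn.
have kD : kap * D < e / 8 by rewrite -ltr_pdivlMr.
have [E [Ef Eg gE]] := symmetrals_epi_support (@ww k) fC
  (tsupp_epi_support fC fz0 (radius_ge z0 j)).
have EL z u : E z u -> enorm z <= L by move=> /Ef[].
have [z1 [v1 [z2 [v2 [l [E1 E2 l01 hz hv]]]]]] :=
  epigraph_point_near_ray (ltW L0) (@mean_lipschitz j) (@mean_radial j)
    (fun y => wP (x := y) jk) e11 EL Eg gE smin kap0 dp t0 sg0 sg1 sg2 kX.
have fkC := symmetrals_Calpha (@ww k) fC; have [_ cvx _ _ _] := (CalphaP _ _).1 fkC.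
have [f1 b1 _] := Ef _ _ E1; have [f2 b2 _] := Ef _ _ E2.
have [fz bz] := cvx _ _ _ f1 f2 l01.
have k1 : 3 * kap / d = kap * (3 / d) by rewrite mulrAC mulrC.
have k2 : 3 * kap / t = kap * (3 / t) by rewrite mulrAC mulrC.
rewrite -/kap tE k1 k2 in hz; rewrite -/kap k1 in hv.
have kit := mulr_gt0 kap0 it; have kid := mulr_gt0 kap0 id.
have ksid := mulr_ge0 (ltW kap0) sid.
have kDE : kap * D = kap * (3 / t) + kap * (3 / d) + kap * (`|s| * (3 / d)) + kap * 2.
  by rewrite /D !mulrDr.
exists (l *: z1 + (1 - l) *: z2); split => //.
  apply: le_lt_trans hz _; rewrite kDE in kD; move: kD kit kid ksid e0.
  move: (kap * (3 / t)) (kap * (3 / d)) (kap * (`|s| * (3 / d))) => q1 q2 q3.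
  by lra.
have /andP[l0 l1] := l01; have l1' : 0 <= 1 - l by lra.
have h1 := ler_wpM2l l0 b1; have h2 := ler_wpM2l l1' b2.
have hh : base (fk k (l *: z1 + (1 - l) *: z2)) <= l * v1 + (1 - l) * v2.
  by apply: le_trans bz _; exact: lerD.
apply: le_lt_trans hh _; apply: le_lt_trans hv _.
rewrite kDE in kD; rewrite (mulrCA `|s|) -(mulrA 2 L d).
move: kD kit kid ksid e0 Ld sval; clear.
move: (kap * (3 / t)) (kap * (3 / d)) (kap * (`|s| * (3 / d))) (L * d) => q1 q2 q3 q4.
by move: (mean j _) (a * s) => M as0; lra.
Qed.

(** The point is first moved towards the origin by at most [e / 2]; radial monotonicity keeps [phi]
    at most [v] there. *)
Lemma symmetrals_recovery x v e : (phi x <= v%:E)%E -> 0 < e ->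
  exists N, forall k, (N <= k)%N -> exists z,
    [/\ 0 < fk k z, enorm (z - x) < e & base (fk k z) < v + e].
Proof.
move=> xv e0; have [phiC phir _] := phiP.
have [e1 e11 xE] := unit_direction x n0; set b := enorm x in xE.
have b0 : 0 <= b := enorm_ge0 x.
have e2 : 0 < e / 2 by rewrite divr_gt0.
pose th := Num.min 1 (e / 2 / (b + 1)).
have th0 : 0 < th by rewrite lt_min ltr01 divr_gt0// ltr_wpDl.
have th1 : th <= 1 by rewrite ge_min lexx.
have thb : th * b <= e / 2.
  have b1 : 0 < b + 1 by lra.
  have : th * (b + 1) <= e / 2 by rewrite -ler_pdivlMr// ge_min lexx orbT.
  by have := mulr_ge0 (ltW th0) b0; lra.
pose a := (1 - th) * b.
have a0 : 0 <= a by rewrite mulr_ge0//; lra.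
have ab : a = 0 \/ a < b.
  have [b00|b00] := eqVneq b 0; first by left; rewrite /a b00 mulr0.
  right; rewrite /a gtr_pMl; [lra|by rewrite lt_def b00].
have bv : (phi (b *: e1) <= v%:E)%E by rewrite -xE.
have av : (phi (a *: e1) <= v%:E)%E.
  apply: (radial_le n0 phiC phir _ bv); rewrite !enormZ e11 !mulr1 !ger0_norm//.
  by case: ab => [->//|/ltW].
have [N NP] := symmetrals_recovery_ray e11 a0 ab bv av e2.
exists N => k /NP[z [fz hz hv]]; exists z; split => //; last by lra.
apply: le_lt_trans (enormBD z (a *: e1) x) _.
have : enorm (a *: e1 - x) <= e / 2.
  rewrite xE -scalerBl enormZ e11 mulr1 distrC ger0_norm; rewrite /a; first lra.
  by have := mulr_ge0 (ltW th0) b0; lra.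
by lra.
Qed.

End LowerLimit.

(** * Hypo-convergence *)

Section LimnEsup.
Context {R : realType}.

Lemma limn_esup_le_real (u : nat -> R) (l : R) :
  (forall a, l < a -> exists N, forall k, (N <= k)%N -> u k <= a) ->
  (limn_esup (fun k => (u k)%:E) <= l%:E)%E.
Proof.
move=> ul; apply/lee_addgt0Pr => e e0.
have [|N NP] := ul (l + e); first by rewrite ltrDl.
apply: (@le_trans _ _ (ereal_sup ((fun k => (u k)%:E) @` [set k | (N <= k)%N]))).
  by apply: ereal_inf_lbound; exists [set k | (N <= k)%N] => //; exists N.
by apply: ge_ereal_sup => _ [k Nk <-]; rewrite -EFinD lee_fin; exact: NP.
Qed.

Lemma le_limn_esup_real (u : nat -> R) (l : R) : (forall k, l <= u k) ->
  (l%:E <= limn_esup (fun k => (u k)%:E))%E.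
Proof.
move=> lu; apply: le_ereal_inf_tmp => _ [V [N _ NV] <-].
apply: (@le_trans _ _ (u N)%:E); first by rewrite lee_fin.
by apply: ereal_sup_ubound; exists N => //; apply: NV => /=.
Qed.

End LimnEsup.

(** * From the symmetrized base function back to [Calpha] *)

Section Unbase.
Context {R : realType} {n : nat}.
Variables (alpha : R) (phi : 'cV[R]_n -> \bar R) (m : R).
Hypotheses (phiC : Convc phi) (dm : bdom alpha m)
  (mphi : forall z v, (phi z <= v%:E)%E -> m <= v).

Local Notation base := (base alpha).
Local Notation ubase := (ubase alpha).
Local Notation bdom := (bdom alpha).
Local Notation g := (unbase alpha phi).

(** The lower bound [m] puts every finite value of [phi] in the range of [base], so the power in
    [unbase] always has a positive argument. *)
Lemma unbase_fin x r : phi x = r%:E -> bdom r /\ g x = ubase r.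
Proof.
move=> xr; split; last by rewrite /unbase xr.
by apply: bdom_le dm _; apply: (mphi (z := x)); rewrite xr.
Qed.

Lemma unbase_cases x : (phi x = +oo%E /\ g x = 0) \/
  (exists r, [/\ phi x = r%:E, bdom r & g x = ubase r]).
Proof.
have [phiNy _ _ _ _] := phiC; have := phiNy x; case xr : (phi x) => [r| |]// _.
  by right; exists r; have [? ?] := unbase_fin xr.
by left; split; rewrite // /unbase xr.
Qed.

Lemma unbase_ge0 x : 0 <= g x.
Proof. by have [[_ ->]//|[r [_ dr ->]]] := unbase_cases x; rewrite ltW// ubase_gt0. Qed.

Lemma unbase_gt0 x : 0 < g x -> phi x = (base (g x))%:E.
Proof.
have [[_ ->]|[r [-> dr ->]]] := unbase_cases x; first by rewrite ltxx.
by rewrite ubaseK.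
Qed.

Lemma unbase_lt x a : 0 < a -> ((base a)%:E < phi x)%E = (g x < a).
Proof.
move=> a0; have [[-> ->]|[r [-> dr ->]]] := unbase_cases x; first by rewrite a0 ltry.
by rewrite lte_fin -[in RHS](baseK alpha a0) lt_ubase//; exact: base_bdom.
Qed.

Lemma unbase_Calpha : Calpha alpha g.
Proof.
have [phiNy _ lphi [x0 phix0] cphi] := phiC; apply/CalphaP; split.
- exact: unbase_ge0.
- move=> x y l /unbase_gt0 xE /unbase_gt0 yE l01.
  have := ext_convex_le phiC l01 (_ : phi x <= (base (g x))%:E)%E (_ : phi y <= (base (g y))%:E)%E.
  rewrite xE yE !lexx => /(_ isT isT).
  have [[-> _]//|[r [-> dr ->]]] := unbase_cases (l *: x + (1 - l) *: y).
  by rewrite lee_fin ubaseK// ubase_gt0.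
- move=> x a ga; have a0 : 0 < a by apply: le_lt_trans ga; exact: unbase_ge0.
  rewrite -unbase_lt// in ga; have [V xV Vphi] := lphi x _ ga.
  have /near_enormP[d d0 dV] : \forall z \near x, V z by [].
  by exists d => // y /dV /Vphi; rewrite unbase_lt.
- exists x0; have [[x0y _]|[r [_ dr ->]]] := unbase_cases x0; last exact: ubase_gt0.
  by rewrite x0y eqxx in phix0.
- move=> e e0; have [r rP] := cphi (base e); exists r => x /rP.
  by rewrite unbase_lt.
Qed.

End Unbase.

Section HypoConvergence.
Context {R : realType} {n : nat}.
Variables (alpha : R) (fk : nat -> 'cV[R]_n -> R) (phi : 'cV[R]_n -> \bar R) (m : R).
Hypotheses (phiC : Convc phi) (dm : bdom alpha m)
  (mphi : forall z v, (phi z <= v%:E)%E -> m <= v).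
Hypothesis fkC : forall k, Calpha alpha (fk k).

Local Notation base := (base alpha).
Local Notation g := (unbase alpha phi).

Hypothesis fk_liminf : forall x b, (b%:E < phi x)%E ->
  exists2 d, 0 < d & exists N, forall k, (N <= k)%N -> forall x' : 'cV[R]_n,
    enorm (x' - x) < d -> 0 < fk k x' -> b < base (fk k x').
Hypothesis fk_recovery : forall x v e, (phi x <= v%:E)%E -> 0 < e ->
  exists N, forall k, (N <= k)%N -> exists z,
    [/\ 0 < fk k z, enorm (z - x) < e & base (fk k z) < v + e].

Lemma fk_ge0 k x : 0 <= fk k x.
Proof. by have [+ _ _ _ _] := (CalphaP _ _).1 (fkC k). Qed.

Lemma fk_upper x (u : nat -> 'cV[R]_n) a : u k @[k --> \oo] --> x -> g x < a ->
  exists N, forall k, (N <= k)%N -> fk k (u k) < a.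
Proof.
move=> /cvg_enormP ux ga.
have a0 : 0 < a by apply: le_lt_trans ga; exact: (unbase_ge0 phiC dm mphi).
rewrite -(unbase_lt phiC dm mphi)// in ga.
have [d d0 [N NP]] := fk_liminf ga; have [N' _ N'P] := ux d d0.
exists (maxn N N') => k; rewrite geq_max => /andP[Nk N'k].
have [->//|fku] := ge0_cases (fk_ge0 k (u k)).
by have := NP k Nk _ (N'P k N'k) fku; rewrite lt_base.
Qed.

(* The recovery sequence almost minimizes [max |z - x| (base (fk k z) - phi x)]. *)
Lemma fk_hypo : hypo_converges fk g.
Proof.
move=> x; split => [u ux|].
  apply: limn_esup_le_real => a ga; have [N NP] := fk_upper ux ga.
  by exists N => k /NP /ltW.
have [[_ gx0]|[v [phixv dv gxv]]] := unbase_cases phiC dm mphi x.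
  (* Where [phi] is infinite the constant sequence works: the values are nonnegative and eventually
     below any [e > 0]. *)
  exists (fun=> x); first exact: cvg_cst.
  rewrite gx0; apply/cvgrPdist_lt => e e0.
  have [|N NP] := @fk_upper x (fun=> x) e (cvg_cst _); first by rewrite gx0.
  exists N => // k /= /NP; rewrite sub0r normrN ger0_norm//; exact: fk_ge0.
pose cost k z := Num.max (enorm (z - x)) (base (fk k z) - v).
have cost0 k z : 0 <= cost k z by rewrite le_max enorm_ge0.
pose S k := [set cost k z | z in [set z | 0 < fk k z]].
have Sinf k : has_inf (S k).
  split; last by exists 0 => _ [z _ <-]; exact: cost0.
  have [_ _ _ [z fz] _] := (CalphaP _ _).1 (fkC k).
  by exists (cost k z), z.
have /choice[u uP] : forall k, exists z, 0 < fk k z /\ cost k z < inf (S k) + k.+1%:R^-1.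
  move=> k; have k0 : 0 < k.+1%:R^-1 :> R by rewrite invr_gt0 ltr0Sn.
  by have [_ [z fz <-] hz] := inf_adherent k0 (Sinf k); exists z.
have small e : 0 < e -> exists N, forall k, (N <= k)%N -> cost k (u k) < e.
  move=> e0; have e2 : 0 < e / 2 by rewrite divr_gt0.
  have [|N NP] := @fk_recovery x v _ _ e2; first by rewrite phixv.
  have [N' N'P] := large_index 0 e2.
  exists (maxn N N') => k; rewrite geq_max => /andP[/NP[z [fz hz hv]] /N'P[k1 _]].
  have [_ hu] := uP k; apply: lt_trans hu _.
  have infz : inf (S k) <= cost k z.
    by apply: ge_inf; [exact: (Sinf k).2|exists z].
  have : cost k z < e / 2 by rewrite gt_max hz /=; lra.
  by move=> h; rewrite (splitr e); apply: ltrD k1; exact: le_lt_trans h.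
have ux : u k @[k --> \oo] --> x.
  apply/cvg_enormP => e /small[N NP]; exists N => // k /= /NP.
  by rewrite gt_max => /andP[].
exists u => //; apply/cvgrPdist_lt => e e0.
have [|N1 N1P] := @fk_upper x u (g x + e) ux; first by rewrite ltrDl.
(* If [g x <= e], positivity is enough; otherwise a small cost forces the base value below
   [base (g x - e)]. *)
have [N2 N2P] : exists N, forall k, (N <= k)%N -> g x - e < fk k (u k).
  have [ge|eg] := leP (g x) e.
    by exists 0%N => k _; apply: le_lt_trans (uP k).1; rewrite subr_le0.
  have ge0 : 0 < g x - e by rewrite subr_gt0.
  have vb : 0 < base (g x - e) - v.
    rewrite subr_gt0 -(ubaseK dv) lt_base ?ubase_gt0// -gxv.
    by rewrite gtrBl.
  have [N NP] := small _ vb; exists N => k /NP.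
  by rewrite gt_max => /andP[_]; rewrite ltrD2r lt_base//; exact: (uP k).1.
exists (maxn N1 N2) => // k /=; rewrite geq_max => /andP[/N1P h1 /N2P h2].
rewrite ltr_norml; lra.
Qed.

End HypoConvergence.

Unset Implicit Arguments.
Set Strict Implicit.
Set Printing Implicit Defensive.

Theorem theorem5p8 (R : realType) (n : nat) (hn : (0 < n)%N)
    (alpha : R) (halpha : alpha <= 0)
    (eta : probability (mxborel R n) R) (heta : is_haar eta)
    (F : ('cV[R]_n -> R) -> R)
    (F_ge0 : forall f, Calpha alpha f -> 0 <= F f)
    (F_usc : hypo_usc (Calpha alpha) F)
    (F_inv : forall f (rho : 'M[R]_n), Calpha alpha f -> orthogonal_group R n rho ->
      F (fun x => f (rho *m x)) = F f)
    (F_incr : forall f (u : 'cV[R]_n), Calpha alpha f -> enorm u = 1 ->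
      F f <= F (symmetral alpha u f))
    (f f_sym : 'cV[R]_n -> R) :
  Calpha alpha f -> is_hypo_sym eta alpha f f_sym -> F f <= F f_sym.
Proof.
move=> fC [phi phiP ->]; have [phiC _ _] := phiP.
have [_ _ _ [z0 fz0] _] := (CalphaP _ _).1 fC.
have [m dm mf] := base_fun_lower fC.
have mphi z v : (phi z <= v%:E)%E -> m <= v.
  exact: (psi_sym_lower heta fC fz0 phiP).
have [w wP] := exists_symmetrizing_words heta hn
  (radius_mono z0) (radius_gt0 z0) (hconj_lipschitz fC fz0).
have ww k : rword (w k) := (wP k).1.
have wm k := (wP k).2.
pose fk k := symmetrals alpha (w k) f.
have fkC k : Calpha alpha (fk k) by exact: symmetrals_Calpha.
have hypo : hypo_converges fk (unbase alpha phi).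
  apply: (fk_hypo phiC dm mphi fkC).
    exact: (symmetrals_liminf hn heta fC fz0 phiP ww wm).
  exact: (symmetrals_recovery hn heta fC fz0 phiP ww wm).
have gC := unbase_Calpha phiC dm mphi.
rewrite -lee_fin; apply: le_trans (F_usc _ _ fkC gC hypo).
by apply: le_limn_esup_real => k; exact: symmetrals_le.
Qed.
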